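(* Fix $\mathsf k\ge1$ and $s\ge0$, and suppose the connected graphs $\{H_i,\ i\in[\mathsf k]\}$ have the same maximal degree $\Delta(H_i)=\Delta\ge2$, and that $H_i$ is $\Delta$-regular if and only if $i\le s$. Then for any $\underline\delta\in\mathbb R_+^{\mathsf k}$ and any $p=p(n)$ with $n^{-1/\Delta}\ll p=o(1)$, $$\lim_{n\to\infty}\phi^{\mathsf k}_{n,p}(\underline H,\mathbf 1+\underline\delta)=c(\underline H,\underline\delta):=\min_{x,y\ge0}\Big\{x+\tfrac12y^2:\ \mathsf P_{H_i^\star}(x)+\mathbb I_{\{i\le s\}}\,y^{\mathsf v(H_i^\star)}\ge1+\delta_i\ \text{ for all } i\le\mathsf k\Big\}.$$
   Context: Graphs are finite and simple; $\mathsf v(H)$, $\mathsf e(H)$ and $\Delta(H)$ are the number of vertices, number of edges and maximal degree of $H$. $a_n\ll b_n$ means $a_n/b_n\to0$ as $n\to\infty$. $\mathbb R_+=[0,\infty)$, inequalities between vectors are coordinate-wise, $\mathbf 1=(1,\dots,1)$, and $\underline H=(H_1,\dots,H_{\mathsf k})$. $H_i^\star$ is the subgraph of $H_i$ induced on its vertices of degree $\Delta$. The independence polynomial of a graph $F$ is $\mathsf P_F(x):=\sum_Sx^{|S|}$, the sum being over all independent sets $S$ of $F$ (including $\emptyset$). $\mathbb I_{\{\cdot\}}$ is the indicator. $\mathcal X_n$ is the set of symmetric $n\times n$ matrices with entries in $[0,1]$ and zero diagonal. For $X\in\mathcal X_n$, $$\mathrm{hom}(H,X):=n^{-\mathsf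 v(H)}p^{-\mathsf e(H)}\sum_{\phi:V(H)\to[n]}\prod_{(k,l)\in E(H)}X(\phi(k),\phi(l)),\qquad \mathrm{hom}(\underline H,X):=(\mathrm{hom}(H_1,X),\dots,\mathrm{hom}(H_{\mathsf k},X)),$$ $I_p(X):=\sum_{1\le i\ne j\le n}I_p(x_{ij})$ with $I_p(x):=x\log\frac xp+(1-x)\log\frac{1-x}{1-p}$ ($0\log 0:=0$), and $$\Phi^{\mathsf k}_{n,p}(\underline H,\underline t):=\tfrac12\inf\{I_p(X):X\in\mathcal X_n,\ \mathrm{hom}(\underline H,X)\ge\underline t\},\qquad a_{n,p}:=n^2p^\Delta\log(1/p),\qquad \phi^{\mathsf k}_{n,p}:=a_{n,p}^{-1}\Phi^{\mathsf k}_{n,p}.$$ *)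

(* Defs.v *)
From HB Require Import structures.
From mathcomp Require Import all_boot all_order all_algebra.
From mathcomp Require Import all_classical all_reals all_analysis.
Import Order.TTheory GRing.Theory Num.Theory.
Import numFieldNormedType.Exports.

Set Implicit Arguments.
Unset Strict Implicit.
Unset Printing Implicit Defensive.

Local Open Scope ring_scope.

Record sgraph := SGraph {
  vertex :> finType;
  adj : rel vertex;
  adj_sym : symmetric adj;
  adj_irr : irreflexive adj }.

Section Graph.
Variable H : sgraph.

(* Each unordered edge {k, l} is represented exactly once, by the pair (k, l)
   in which k comes first in the enumeration of the vertices. *)
Definition edges : {set H * H} :=
  [set u : H * H | adj u.1 u.2 && (enum_rank u.1 < enum_rank u.2)%N].

Definition deg (x : H) : nat := #|[set y | adj x y]|.
Definition maxdeg : nat := \max_(x : H) deg x.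
Definition regular (d : nat) : Prop := forall x : H, deg x = d.
Definition connected_graph : Prop :=
  (0 < #|H|)%N /\ forall x y : H, connect (@adj H) x y.

Definition independent (S : {set H}) : bool :=
  [forall x in S, forall y in S, ~~ adj x y].

Definition indep_poly (R : realType) : {poly R} :=
  \sum_(S : {set H} | independent S) 'X^#|S|.

End Graph.

Section Induced.
Variables (H : sgraph) (S : {set H}).

Definition induced_adj : rel {x : H | x \in S} :=
  fun u v => adj (val u) (val v).

Lemma induced_adj_sym : symmetric induced_adj.
Proof. by move=> u v; rewrite /induced_adj adj_sym. Qed.

Lemma induced_adj_irr : irreflexive induced_adj.
Proof. by move=> u; rewrite /induced_adj adj_irr. Qed.

Definition induced : sgraph := SGraph induced_adj_sym induced_adj_irr.
End Induced.

Definition star (H : sgraph) : sgraph :=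
  induced [set x : H | deg x == maxdeg H].

Local Open Scope classical_set_scope.

Section Variational.
Variable R : realType.

Definition wgraph (n : nat) : set 'M[R]_n :=
  [set X | [/\ X^T = X, forall i j, 0 <= X i j <= 1 & forall i, X i i = 0]].

(* As X is symmetric, the product does not depend on the orientation of the
   edges chosen in [edges]. *)
Definition hom_density (n : nat) (p : R) (H : sgraph) (X : 'M[R]_n) : R :=
  n%:R ^- #|H| * p ^- #|edges H| *
  \sum_(phi : {ffun H -> 'I_n}) \prod_(u in edges H) X (phi u.1) (phi u.2).

(* The convention 0 log 0 = 0 is automatic. *)
Definition relent (p x : R) : R :=
  x * ln (x / p) + (1 - x) * ln ((1 - x) / (1 - p)).

Definition relent_mx (n : nat) (p : R) (X : 'M[R]_n) : R :=
  \sum_(i < n) \sum_(j < n | i != j) relent p (X i j).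

Definition admissible (n : nat) (p : R) (k : nat) (H : 'I_k -> sgraph)
    (t : 'I_k -> R) : set 'M[R]_n :=
  [set X | wgraph X /\ forall i, t i <= hom_density p (H i) X].

(* Extended real valued, so that the infimum over the empty set is +oo. *)
Definition Phi (n : nat) (p : R) (k : nat) (H : 'I_k -> sgraph)
    (t : 'I_k -> R) : \bar R :=
  ((2^-1)%:E *
   ereal_inf [set (relent_mx p X)%:E | X in @admissible n p k H t])%E.

Definition anp (Delta n : nat) (p : R) : R :=
  n%:R ^+ 2 * p ^+ Delta * ln p^-1.

Definition phi (Delta n : nat) (p : R) (k : nat) (H : 'I_k -> sgraph)
    (t : 'I_k -> R) : \bar R :=
  (((anp Delta n p)^-1)%:E * Phi n p H t)%E.

(* The family [H] is indexed from 0: [i < s] says that H_i is among the first s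
   graphs. *)
Definition feasible (k s : nat) (H : 'I_k -> sgraph) (delta : 'I_k -> R)
    (x y : R) : Prop :=
  [/\ 0 <= x, 0 <= y &
    forall i, 1 + delta i <=
      (indep_poly (star (H i)) R).[x] + (i < s)%N%:R * y ^+ #|star (H i)|].

Definition objective_values (k s : nat) (H : 'I_k -> sgraph)
    (delta : 'I_k -> R) : set R :=
  [set z | exists x y, feasible s H delta x y /\ z = x + 2^-1 * y ^+ 2].

Definition is_minimum (A : set R) (m : R) : Prop := A m /\ lbound A m.

End Variational.

(* Main.v *)
Require Import Defs.
From HB Require Import structures.
From mathcomp Require Import all_boot all_order all_algebra.
From mathcomp Require Import all_classical all_reals all_analysis.
From mathcomp Require Import ring lra.
Import Order.TTheory GRing.Theory Num.Theory.
Import numFieldNormedType.Exports.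

Set Implicit Arguments.
Unset Strict Implicit.
Unset Printing Implicit Defensive.

Local Open Scope ring_scope.

(** The cheapest way to raise all densities at once is to plant in the constant
    weight [p] two structures whose entries are 1: about [x p^Delta n] hubs
    joined to everything, and a clique on about [y p^(Delta/2) n] vertices. They
    cost [x] and [y^2 / 2] in units of [n^2 p^Delta log (1/p)]. Hubs are used
    by sending to them an independent set of vertices of degree [Delta], which
    gives the independence polynomial of the star graph; the clique is only
    used by a whole [Delta]-regular graph, which gives [y^v].

    Lower bound on the limit. Let [U] be the positive part of [X - p]. Raising
    an entry from [p] to [p + u] costs about [u log (1/p)] when [u] is not
    small ([relent_ge_linear]), and at least [u^2 log (1/p) / (4 eps)] when
    [u <= eps] ([relent_ge_square]). If [X] costs [O(n^2 p^Delta log (1/p))],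
    the entries of [U] below [eps] are therefore negligible, by Finner's
    inequality ([finner], [dens_perturb]), and the total mean of the others is
    [O(p^Delta)]; in particular only a fraction [O(p^Delta / beta)] of the rows,
    the hubs, have mean above [beta]. Expand the density of [1 + U / p] over
    the set [F] of edges on which [U / p] is chosen and the set [S] of vertices
    that are sent to hubs. Bounding the edges that touch [S] by 1 and the others
    by Finner's inequality and counting powers of [p], a pair [(F, S)] is
    negligible unless [S] is an independent set of vertices of degree [Delta]
    all of whose edges are in [F] ([term_le_hubs], [touching_saturated]). If no
    other edge is in [F], Finner's inequality bounds the term by [theta^|S|],
    where [theta] is the normalised mass of the rows of hubs. Otherwise look at
    the edges of [F] that avoid [S]. If some vertex is on at least one but fewer
    than [Delta] of them, Hölder's inequality at that vertex is not tight and
    the term is small because rows away from the hubs have small mean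
    ([edge_finner_deficient]); if there is no such vertex, connectedness forces
    the graph to be regular, [F] to contain all edges and [S] to be empty
    ([full_component]), and the term is at most [y^v] with [y^2] the normalised
    mass away from the hubs. Hence [(theta, y)] is nearly feasible, while [X]
    costs at least nearly [theta + y^2 / 2].

    One difficulty is that the number of hubs brings a factor [1 / beta] per
    vertex of [S], while the gain just mentioned is a power of the bound on the
    other row means; with a single threshold the loss may win. So the rows with
    mean between two thresholds [gamma] and [beta] are discarded, with [gamma]
    much smaller than [beta]. Among many disjoint layers of this kind one
    carries little mass ([light_layer]), so that discarding it is harmless.

    Upper bound. The planted weights have density at least about [P(x) + y^v],
    with [P] the independence polynomial and [y^v] only for a regular graph
    ([dens_full_ge]). Setting their diagonal to 0 changes the density by an
    amount that tends to 0 because [n p^Delta] tends to infinity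
    ([hom_planted_ge]). *)

(** * Means over finite types and Hölder's inequality *)

Section Mean.
Variable R : realType.
Implicit Types T : finType.

Definition mean {T : finType} (f : T -> R) : R := #|T|%:R^-1 * \sum_x f x.

Lemma eq_mean T (f g : T -> R) : f =1 g -> mean f = mean g.
Proof. by move=> fg; rewrite /mean (eq_bigr _ (fun x _ => fg x)). Qed.

Lemma le_mean T (f g : T -> R) : (forall x, f x <= g x) -> mean f <= mean g.
Proof. by move=> fg; rewrite ler_wpM2l ?invr_ge0 ?ler0n ?ler_sum. Qed.

Lemma mean_ge0 T (f : T -> R) : (forall x, 0 <= f x) -> 0 <= mean f.
Proof. by move=> f0; rewrite mulr_ge0 ?invr_ge0 ?ler0n ?sumr_ge0. Qed.

Lemma mean_cst T (c : R) : (0 < #|T|)%N -> mean (fun _ : T => c) = c.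
Proof.
move=> T0; rewrite /mean sumr_const -[c *+ _]mulr_natl mulrA mulVf ?mul1r //.
by rewrite pnatr_eq0 -lt0n.
Qed.

Lemma meanZ T (c : R) (f : T -> R) : mean (fun x => c * f x) = c * mean f.
Proof. by rewrite /mean -mulr_sumr mulrCA. Qed.

Lemma meanD T (f g : T -> R) : mean (fun x => f x + g x) = mean f + mean g.
Proof. by rewrite /mean big_split mulrDr. Qed.

Lemma mean_sum T (I : finType) (P : pred I) (f : I -> T -> R) :
  mean (fun x => \sum_(i | P i) f i x) = \sum_(i | P i) mean (f i).
Proof. by rewrite /mean exchange_big mulr_sumr. Qed.

Lemma mean_eq0 T (f : T -> R) :
  (forall x, 0 <= f x) -> mean f = 0 -> forall x, f x = 0.
Proof.
move=> f0 /eqP; rewrite mulf_eq0 invr_eq0 pnatr_eq0 => /orP[/eqP T0 x|].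
  by have := card0_eq T0 x; rewrite inE.
rewrite psumr_eq0 // => /allP f_eq0 x.
by apply/eqP/f_eq0; rewrite mem_index_enum.
Qed.

Lemma mean_exchange T T' (f : T -> T' -> R) :
  mean (fun x => mean (f x)) = mean (fun y => mean (f^~ y)).
Proof.
rewrite /mean -!mulr_sumr exchange_big /= mulrCA; congr (_ * (_ * _)).
Qed.

(** The missing weight [1 - \sum_i w i] sits on the constant 1. The exponential
    lies above its tangent at [\sum_i w i * ln (y i)]; average the values of
    the two at the points [ln (y i)] and at 0. *)
Lemma weighted_AGM (I : finType) (P : pred I) (w y : I -> R) :
  (forall i, P i -> 0 < w i) -> (forall i, P i -> 0 <= y i) ->
  \sum_(i | P i) w i <= 1 ->
  \prod_(i | P i) (y i) `^ (w i) <= 1 + \sum_(i | P i) w i * (y i - 1).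
Proof.
move=> w0 y0 w1.
have -> : 1 + \sum_(i | P i) w i * (y i - 1) =
    (1 - \sum_(i | P i) w i) + \sum_(i | P i) w i * y i.
  by under eq_bigr do rewrite mulrBr mulr1; rewrite big_split /= sumrN; ring.
have [/existsP[i /andP[Pi /eqP yi0]]|] := boolP [exists i, P i && (y i == 0)].
  rewrite (bigD1 i) //= yi0 powR0 ?mul0r; last by rewrite gt_eqF ?w0.
  rewrite addr_ge0 ?subr_ge0 //; apply: sumr_ge0 => j Pj.
  by rewrite mulr_ge0 ?y0 ?ltW ?w0.
rewrite negb_exists => /forallP yN0.
have y_gt0 i : P i -> 0 < y i.
  by move=> Pi; rewrite lt_neqAle y0 // andbT eq_sym; have := yN0 i; rewrite Pi.
set L := \sum_(i | P i) w i * ln (y i).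
have -> : \prod_(i | P i) y i `^ w i = expR L.
  rewrite expR_sum; apply: eq_bigr => i Pi.
  by rewrite /powR gt_eqF ?y_gt0.
have tangent z : expR L * (1 + (z - L)) <= expR z.
  have {2}-> : z = L + (z - L) by ring.
  by rewrite expRD ler_pM2l ?expR_gt0 ?expR_ge1Dx.
have h1 : (1 - \sum_(i | P i) w i) * (expR L * (1 + (0 - L))) <=
    1 - \sum_(i | P i) w i.
  by rewrite ler_piMr ?subr_ge0 // -[leRHS]expR0.
have h2 : \sum_(i | P i) w i * (expR L * (1 + (ln (y i) - L))) <=
    \sum_(i | P i) w i * y i.
  apply: ler_sum => i Pi; rewrite ler_pM2l ?w0 //.
  by rewrite (le_trans (tangent _)) // lnK // posrE y_gt0.
apply: le_trans (lerD h1 h2).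
have -> : \sum_(i | P i) w i * (expR L * (1 + (ln (y i) - L))) =
    expR L * ((1 - L) * (\sum_(i | P i) w i) + L).
  rewrite /L mulrDr mulrA !mulr_sumr -big_split /=.
  by apply: eq_bigr => i _; rewrite -/L; ring.
by rewrite le_eqVlt; apply/orP; left; apply/eqP; ring.
Qed.

(** [weighted_AGM] applied pointwise to the functions divided by their means. *)
Lemma weighted_hoelder T (I : finType) (P : pred I) (w : I -> R)
    (a : I -> T -> R) : (0 < #|T|)%N ->
  (forall i, P i -> 0 < w i) -> (forall i x, P i -> 0 <= a i x) ->
  \sum_(i | P i) w i <= 1 ->
  mean (fun x => \prod_(i | P i) (a i x) `^ (w i)) <=
  \prod_(i | P i) (mean (a i)) `^ (w i).
Proof.
move=> T0 w0 a0 w1.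
have m0 i : P i -> 0 <= mean (a i) by move=> Pi; apply: mean_ge0 => x; apply: a0.
have [/existsP[i /andP[Pi /eqP ai0]]|] := boolP [exists i, P i && (mean (a i) == 0)].
  rewrite (@eq_mean _ _ (fun => 0)) ?mean_cst // => [|x].
    by apply: prodr_ge0 => j _; rewrite powR_ge0.
  have aix : a i x = 0 by apply: mean_eq0 => // z; apply: a0.
  by rewrite (bigD1 i) //= aix powR0 ?mul0r // gt_eqF ?w0.
rewrite negb_exists => /forallP mN0.
have m_gt0 i : P i -> 0 < mean (a i).
  by move=> Pi; rewrite lt_neqAle m0 // andbT eq_sym; have := mN0 i; rewrite Pi.
pose M := \prod_(i | P i) (mean (a i)) `^ (w i).
have normalise x : \prod_(i | P i) (a i x) `^ (w i) =
    M * \prod_(i | P i) (a i x / mean (a i)) `^ (w i).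
  rewrite /M -big_split /=; apply: eq_bigr => i Pi.
  rewrite -powRM ?m0 ?divr_ge0 ?a0 ?m0 // mulrCA mulfV ?mulr1 //.
  by rewrite gt_eqF ?m_gt0.
under eq_mean do rewrite normalise.
rewrite meanZ -/M; apply: ler_piMr; first by apply: prodr_ge0 => *; rewrite powR_ge0.
apply: (@le_trans _ _ (mean (fun x =>
    1 + \sum_(i | P i) w i * (a i x / mean (a i) - 1)))).
  by apply: le_mean => x; apply: weighted_AGM => // i Pi; rewrite divr_ge0 ?a0 ?m0.
rewrite meanD mean_cst // mean_sum big1 ?addr0 // => i Pi.
rewrite meanZ meanD mean_cst // (@eq_mean _ _ (fun x => (mean (a i))^-1 * a i x)).
  by rewrite meanZ mulVf ?subrr ?mulr0 // gt_eqF ?m_gt0.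
by move=> x; rewrite mulrC.
Qed.

End Mean.

(** * Finner's inequality *)

Section Finner.
Variables (R : realType) (V T : finType).
Hypothesis T0 : (0 < #|T|)%N.
Implicit Types (f g : {ffun V -> T} -> R) (phi : {ffun V -> T}).

Definition upd phi (v : V) (t : T) : {ffun V -> T} :=
  [ffun x => if x == v then t else phi x].

Definition depends_on f (D : {set V}) :=
  forall phi psi : {ffun V -> T}, (forall v, v \in D -> phi v = psi v) -> f phi = f psi.

(** The conditional expectation of [f] given all coordinates but [v]. *)
Definition avg (v : V) f : {ffun V -> T} -> R := fun phi => mean (fun t => f (upd phi v t)).

Lemma card_ffun_gt0 : (0 < #|{ffun V -> T}|)%N.
Proof. by rewrite card_ffun expn_gt0 T0. Qed.

Lemma avg_ge0 v f : (forall phi, 0 <= f phi) -> forall phi, 0 <= avg v f phi.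
Proof. by move=> f0 phi; apply: mean_ge0. Qed.

(** Reindexing by [(phi, t) |-> (upd phi v t, phi v)], which is an involution. *)
Lemma mean_avg v f : mean (avg v f) = mean f.
Proof.
transitivity (mean (fun _ : T => mean f)); last exact: mean_cst.
rewrite /mean -mulr_sumr mulrCA; congr (_ * _).
rewrite -mulr_sumr; congr (_ * _).
rewrite !pair_big /=.
pose h (x : {ffun V -> T} * T) := (upd x.1 v x.2, x.1 v).
have hK : involutive h.
  case=> phi t; rewrite /h /=; congr (_, _); last by rewrite ffunE eqxx.
  by apply/ffunP => x; rewrite !ffunE; case: eqP => // ->.
rewrite (reindex h) /=; last by exists h => x _; exact: hK.
rewrite -(pair_big xpredT xpredT (fun (phi : {ffun V -> T}) (t : T) =>
  f (upd (upd phi v t) v (phi v)))) /=.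
rewrite -(pair_big xpredT xpredT (fun (t : T) (phi : {ffun V -> T}) => f phi)) /=.
rewrite exchange_big /=; apply: eq_bigr => t _; apply: eq_bigr => phi _.
by congr f; apply/ffunP => x; rewrite !ffunE; case: eqP => // ->.
Qed.

Lemma avg_indep v f D : depends_on f D -> v \notin D -> avg v f =1 f.
Proof.
move=> fD vD phi; rewrite /avg -[RHS](mean_cst _ T0); apply: eq_mean => t.
by apply: fD => x xD; rewrite ffunE; case: eqP => // xv; rewrite -xv xD in vD.
Qed.

Lemma depends_on_avg v f D : depends_on f D -> depends_on (avg v f) (D :\ v).
Proof.
move=> fD phi psi e; apply: eq_mean => t; apply: fD => x xD; rewrite !ffunE.
by case: (eqVneq x v) => // xv; apply: e; rewrite !inE xv.
Qed.

Lemma depends_onS f (D E : {set V}) : D \subset E -> depends_on f D -> depends_on f E.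
Proof. by move=> /fintype.subsetP DE fD phi psi e; apply: fD => v /DE; apply: e. Qed.

(** Functions that do not see the coordinate [v] leave the mean over it, so
    Hölder's inequality is only applied to those that do. *)
Lemma avg_hoelder (I : finType) (P : pred I) (w : I -> R)
    (F : I -> {ffun V -> T} -> R) (dep : I -> {set V}) v :
  (forall i, P i -> 0 < w i) -> (forall i phi, P i -> 0 <= F i phi) ->
  (forall i, P i -> depends_on (F i) (dep i)) ->
  \sum_(i | P i && (v \in dep i)) w i <= 1 ->
  forall phi, avg v (fun psi => \prod_(i | P i) F i psi `^ w i) phi <=
              \prod_(i | P i) avg v (F i) phi `^ w i.
Proof.
move=> w0 F0 FD w1 phi; rewrite /avg.
rewrite (bigID (fun i => v \in dep i)) /=.
have -> : \prod_(i | P i && (v \notin dep i)) mean (fun t => F i (upd phi v t)) `^ w i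
   = \prod_(i | P i && (v \notin dep i)) F i phi `^ w i.
  apply: eq_bigr => i /andP[Pi vi]; congr (_ `^ _).
  by apply: (avg_indep (FD i Pi)).
rewrite (@eq_mean _ _ _ (fun t => \prod_(i | P i && (v \notin dep i)) F i phi `^ w i *
    \prod_(i | P i && (v \in dep i)) F i (upd phi v t) `^ w i)); last first.
  move=> t; rewrite (bigID (fun i => v \in dep i)) /= mulrC; congr (_ * _).
  apply: eq_bigr => i /andP[Pi vi]; congr (_ `^ _); apply: (FD i Pi) => x xD.
  by rewrite ffunE; case: eqP => // xv; rewrite -xv xD in vi.
rewrite meanZ mulrC ler_wpM2r //; first by apply: prodr_ge0 => *; rewrite powR_ge0.
apply: weighted_hoelder => //; first by move=> i /andP[/w0].
by move=> i x /andP[Pi _]; apply: F0.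
Qed.

Definition avgs (s : seq V) f := foldr avg f s.

Lemma avgs_ge0 s f : (forall phi, 0 <= f phi) -> forall phi, 0 <= avgs s f phi.
Proof. by move=> f0; elim: s => //= v s IH; apply: avg_ge0. Qed.

Lemma depends_on_avgs s f D :
  depends_on f D -> depends_on (avgs s f) [set x in D | x \notin s].
Proof.
move=> fD; elim: s => [|v s IH] /=.
  by apply: (depends_onS _ fD); apply/fintype.subsetP => x xD; rewrite !inE xD.
apply: (depends_onS _ (depends_on_avg (v:=v) IH)); apply/fintype.subsetP => x.
by rewrite !inE negb_or => /and3P[-> -> ->].
Qed.

Lemma mean_avgs s f : mean (avgs s f) = mean f.
Proof. by elim: s => //= v s <-; exact: mean_avg. Qed.

Lemma avgs_enum f phi : avgs (enum V) f phi = mean f.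
Proof.
rewrite -(mean_avgs (enum V)) -[LHS](mean_cst _ card_ffun_gt0).
apply: eq_mean => psi.
have fT : depends_on f [set: V] by move=> p1 p2 e; congr f; apply/ffunP => x; apply: e.
by apply: (depends_on_avgs (s:=enum V) fT) => x; rewrite inE mem_enum andbF.
Qed.

(** Finner's inequality: the mean of a product factorises, up to the weights,
    as soon as no coordinate carries total weight more than 1. Coordinates are
    integrated out one at a time, each time by Hölder's inequality. *)
Lemma finner (I : finType) (P : pred I) (w : I -> R)
    (F : I -> {ffun V -> T} -> R) (dep : I -> {set V}) :
  (forall i, P i -> 0 < w i) -> (forall i phi, P i -> 0 <= F i phi) ->
  (forall i, P i -> depends_on (F i) (dep i)) ->
  (forall v, \sum_(i | P i && (v \in dep i)) w i <= 1) ->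
  mean (fun phi => \prod_(i | P i) F i phi `^ w i) <=
  \prod_(i | P i) mean (F i) `^ w i.
Proof.
move=> w0 F0 FD w1.
suff H s : mean (fun phi => \prod_(i | P i) F i phi `^ w i) <=
    mean (fun phi => \prod_(i | P i) avgs s (F i) phi `^ w i).
  apply: le_trans (H (enum V)) _.
  rewrite (eq_mean (g := fun=> \prod_(i | P i) mean (F i) `^ w i)).
    by rewrite mean_cst ?card_ffun_gt0.
  by move=> phi; apply: eq_bigr => i _; rewrite avgs_enum.
elim: s => [|v s IH] //=; apply: le_trans IH _.
rewrite -(mean_avg v); apply: le_mean => phi.
apply: (avg_hoelder (dep := dep)) => // i.
- by move=> psi Pi; apply: avgs_ge0 => ?; apply: F0.
- move=> Pi; apply: (depends_onS _ (depends_on_avgs (s:=s) (FD i Pi))).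
  by apply/fintype.subsetP => x; rewrite inE => /andP[].
Qed.

(** The case of two functions of weight 1 on complementary sets of coordinates. *)
Lemma mean_indep f g (D : {set V}) : (forall phi, 0 <= f phi) -> (forall phi, 0 <= g phi) ->
  depends_on f D -> depends_on g (~: D) ->
  mean (fun phi => f phi * g phi) <= mean f * mean g.
Proof.
move=> f0 g0 fD gD.
have := @finner bool xpredT (fun=> 1) (fun b => if b then f else g)
  (fun b => if b then D else ~: D).
rewrite !big_bool /= !powRr1 ?mean_ge0 //.
under eq_mean do rewrite big_bool /= !powRr1 //.
apply => //; try by case.
by move=> v; rewrite big_mkcond big_bool /= inE; case: (v \in D); rewrite ?addr0 ?add0r.
Qed.

Lemma mean_pair (g : T -> T -> R) (k l : V) : k != l ->
  mean (fun phi : {ffun V -> T} => g (phi k) (phi l)) = mean (fun x => mean (g x)).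
Proof.
move=> kl; rewrite -(mean_avg k) -(mean_avg l).
rewrite -[RHS](mean_cst _ card_ffun_gt0); apply: eq_mean => phi.
rewrite /avg mean_exchange; apply: eq_mean => x; apply: eq_mean => y.
by rewrite !ffunE !eqxx eq_sym (negbTE kl).
Qed.

Lemma mean_prod (g : V -> T -> R) :
  mean (fun phi : {ffun V -> T} => \prod_v g v (phi v)) = \prod_v mean (g v).
Proof.
rewrite /mean card_ffun big_split /= prodr_const bigA_distr_bigA /= natrX.
by rewrite exprVn cardT -cardE.
Qed.

End Finner.

(** * Finner's inequality along the edges of a graph *)

(** Replacing the factors [a i + b i] by [a i] one after the other; each
    replacement costs one term of the sum. *)
Lemma le_prodD (R : realType) (I : finType) (A : {set I}) (a b : I -> R) :
  (forall i, 0 <= a i) -> (forall i, 0 <= b i) ->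
  \prod_(i in A) (a i + b i) <=
  \prod_(i in A) a i + \sum_(i in A) b i * \prod_(j in A :\ i) (a j + b j).
Proof.
move=> a0 b0; have [m] := ubnP #|A|; elim: m A => // m IH A.
have [->|[k kA]] := set_0Vmem A; first by rewrite !big_set0 addr0.
rewrite (cardsD1 k) kA ltnS => /IH{}IH.
rewrite !(big_setD1 k kA) /=; set X := \prod_(i in A :\ k) (a i + b i) in IH *.
rewrite mulrDl addrCA [leLHS]addrC lerD2l.
apply: le_trans (ler_wpM2l (a0 k) IH) _.
rewrite mulrDr lerD2l mulr_sumr; apply: ler_sum => i; rewrite !inE => /andP[ik iA].
rewrite mulrCA ler_wpM2l // [leRHS](big_setD1 k) ?inE 1?eq_sym ?ik //=.
rewrite finset.setDDl finset.setUC -finset.setDDl ler_wpM2r ?lerDl //.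
by apply: prodr_ge0 => j _; rewrite addr_ge0.
Qed.

Section Edges.
Variables (H : sgraph).
Implicit Types (F : {set H * H}) (v : H) (u : H * H).

Definition incident F v : {set H * H} := [set u in F | v \in [set u.1; u.2]].

Lemma in_incident F v u :
  (u \in incident F v) = (u \in F) && ((u.1 == v) || (u.2 == v)).
Proof. by rewrite inE in_set2 ![v == _]eq_sym. Qed.

Lemma edge_adj u : u \in edges H -> adj u.1 u.2.
Proof. by rewrite inE => /andP[]. Qed.

Lemma edge_neq u : u \in edges H -> u.1 != u.2.
Proof. by move/edge_adj; apply: contraTneq => ->; rewrite adj_irr. Qed.

Lemma adj_edge x y : adj x y -> ((x, y) \in edges H) || ((y, x) \in edges H).
Proof.
move=> xy; rewrite !inE /= xy adj_sym xy /=.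
case: (ltngtP (enum_rank x) (enum_rank y)) => // /ord_inj /enum_rank_inj e.
by rewrite e adj_irr in xy.
Qed.

(** Every edge is stored once, in an arbitrary direction; sending an edge at [v]
    to its other end is a bijection onto the neighbours of [v]. *)
Lemma card_incident v : #|incident (edges H) v| = deg v.
Proof.
rewrite /deg -(@card_in_imset _ _ (fun u => if u.1 == v then u.2 else u.1)).
  apply: eq_card => y; rewrite inE; apply/imsetP/idP => [[u]|vy].
    rewrite in_incident => /andP[/edge_adj uadj].
    case: (eqVneq u.1 v) uadj => [<- uadj _ ->//|_ uadj /= /eqP <- ->].
    by rewrite adj_sym.
  case/orP: (adj_edge vy) => e.
    by exists (v, y); rewrite ?in_incident ?e ?eqxx.
  exists (y, v); first by rewrite in_incident e eqxx orbT.
  by rewrite /=; case: eqP => // ->.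
move=> [x y] [x' y']; rewrite !in_incident !inE /= => /andP[/andP[a1 l1] v1] /andP[/andP[a2 l2] v2].
case: (eqVneq x v) v1 => [xv _|_ /= /eqP yv]; case: (eqVneq x' v) v2 => [xv' _|_ /= /eqP yv'] e.
- by rewrite xv xv' e.
- by move: l1 l2; rewrite xv -yv' -e => l1 /ltnW; rewrite leqNgt l1.
- by move: l1 l2; rewrite xv' -yv e => l1 /ltnW; rewrite leqNgt l1.
- by rewrite yv yv' e.
Qed.

Lemma incidentS F F' v : F \subset F' -> (#|incident F v| <= #|incident F' v|)%N.
Proof.
move=> FF; apply/subset_leq_card/fintype.subsetP => u; rewrite !in_incident => /andP[uF ->].
by rewrite (fintype.subsetP FF).
Qed.

Lemma incident_edges_le Delta F v : maxdeg H = Delta -> F \subset edges H ->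
  (#|incident F v| <= Delta)%N.
Proof.
move=> <- FE; apply: leq_trans (incidentS v FE) _.
by rewrite card_incident; apply: (leq_bigmax v).
Qed.

End Edges.

Section EdgeFinner.
Variables (R : realType) (T : finType).
Hypothesis T0 : (0 < #|T|)%N.

Definition mean2 (g : T -> T -> R) : R := mean (fun x => mean (g x)).

Lemma mean2_ge0 (g : T -> T -> R) : (forall x y, 0 <= g x y) -> 0 <= mean2 g.
Proof. by move=> g0; apply: mean_ge0 => x; apply: mean_ge0. Qed.

Lemma le_mean2 (g h : T -> T -> R) :
  (forall x y, g x y <= h x y) -> mean2 g <= mean2 h.
Proof. by move=> gh; apply: le_mean => x; apply: le_mean. Qed.

Lemma mean2D (g h : T -> T -> R) :
  mean2 (fun x y => g x y + h x y) = mean2 g + mean2 h.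
Proof. by rewrite /mean2 -meanD; apply: eq_mean => x; rewrite meanD. Qed.

Lemma mean2Z c (g : T -> T -> R) : mean2 (fun x y => c * g x y) = c * mean2 g.
Proof. by rewrite /mean2 -meanZ; apply: eq_mean => x; rewrite meanZ. Qed.

Lemma mean2_cst (c : R) : mean2 (fun _ _ => c) = c.
Proof. by rewrite /mean2 !mean_cst. Qed.

Variables (H : sgraph) (D : nat).
Hypothesis D0 : (0 < D)%N.

Lemma sum_weight (F : {set H * H}) v :
  (#|incident F v| <= D)%N ->
  \sum_(u in F | v \in [set u.1; u.2]) (D%:R^-1 : R) <= 1.
Proof.
move=> FD; rewrite sumr_const -[_ *+ _]mulr_natr mulrC ler_pdivrMr ?ltr0n // mul1r ler_nat.
by apply: leq_trans FD; apply: eq_leq; apply: eq_card => u; rewrite [RHS]inE.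
Qed.

Lemma powR_root (x : R) : 0 <= x -> (x ^+ D) `^ (D%:R^-1) = x.
Proof.
move=> x0; rewrite -powR_mulrn // -powRrM mulfV ?powRr1 //.
by rewrite pnatr_eq0 -lt0n.
Qed.

(** Finner's inequality with all weights equal to [D^-1], which is allowed since
    no vertex is on more than [D] edges. *)
Lemma edge_finner (F : {set H * H}) (g : H * H -> T -> T -> R) :
  F \subset edges H -> (forall v, #|incident F v| <= D)%N ->
  (forall u x y, 0 <= g u x y) ->
  mean (fun phi : {ffun H -> T} => \prod_(u in F) g u (phi u.1) (phi u.2)) <=
  \prod_(u in F) (mean2 (fun x y => g u x y ^+ D)) `^ (D%:R^-1).
Proof.
move=> FE Fdeg g0.
have := @finner R H T T0 (H * H)%type (mem F) (fun=> D%:R^-1)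
  (fun u phi => g u (phi u.1) (phi u.2) ^+ D) (fun u => [set u.1; u.2]).
under eq_mean do under eq_bigr do rewrite powR_root //.
under [X in _ -> _ -> _ -> _ -> _ <= X]eq_bigr => u uF do
  rewrite (mean_pair T0 (fun x y => g u x y ^+ D) (edge_neq (fintype.subsetP FE _ uF))).
apply.
- by move=> u _; rewrite invr_gt0 ltr0n.
- by move=> u phi _; rewrite exprn_ge0.
- by move=> u _ phi psi e; rewrite !e // !inE eqxx ?orbT.
- by move=> v; apply: sum_weight.
Qed.

Lemma edge_finner_le (F : {set H * H}) (g : H * H -> T -> T -> R) (c : H * H -> R) :
  F \subset edges H -> (forall v, #|incident F v| <= D)%N ->
  (forall u x y, 0 <= g u x y) ->
  (forall u, u \in F -> mean2 (fun x y => g u x y ^+ D) <= c u) ->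
  mean (fun phi : {ffun H -> T} => \prod_(u in F) g u (phi u.1) (phi u.2)) <=
  \prod_(u in F) (c u) `^ (D%:R^-1).
Proof.
move=> FE Fdeg g0 gc; apply: le_trans (edge_finner FE Fdeg g0) _.
apply: ler_prod => u uF; rewrite powR_ge0 /=.
have m0 : 0 <= mean2 (fun x y => g u x y ^+ D).
  by apply: mean2_ge0 => x y; rewrite exprn_ge0.
apply: ge0_ler_powR; rewrite ?nnegrE ?invr_ge0 ?ler0n //.
  exact: le_trans (gc u uF).
exact: gc.
Qed.

(** If rows of [U] have mean at most [gamma] and [v] is incident to fewer than
    [D] edges, then integrating out [v] first leaves room, in Hölder's
    inequality, to count one edge at [v] twice; the extra copy is worth
    [gamma `^ D^-1]. *)
Lemma edge_finner_deficient (F : {set H * H}) (U : T -> T -> R) (gamma : R) (v : H) :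
  F \subset edges H -> (forall v, #|incident F v| <= D)%N ->
  (0 < #|incident F v| < D)%N ->
  (forall x y, 0 <= U x y <= 1) -> (forall x y, U x y = U y x) ->
  (forall x, mean (U x) <= gamma) ->
  mean (fun phi : {ffun H -> T} => \prod_(u in F) U (phi u.1) (phi u.2)) <=
  gamma `^ (D%:R^-1) * \prod_(u in F) (mean2 U) `^ (D%:R^-1).
Proof.
move=> FE Fdeg /andP[/card_gt0P[e0]]; rewrite inE => /andP[e0F ve0] vD U01 Usym Ug.
have U0 x y : 0 <= U x y by have /andP[] := U01 x y.
have U1 x y : U x y <= 1 by have /andP[] := U01 x y.
have Dinv0 : 0 < (D%:R^-1 : R) by rewrite invr_gt0 ltr0n.
(* the edge e0 at v is the one that is counted twice *)
pose w u : R := if u == e0 then 2 / D%:R else D%:R^-1.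
have D2 : (2 <= D)%N.
  apply: leq_trans vD; rewrite ltnS; apply/card_gt0P; exists e0; rewrite inE e0F; exact: ve0.
have w01 u : 0 < w u <= 1.
  rewrite /w; case: eqP => _; rewrite ?divr_gt0 ?ltr0n //=.
    by rewrite ler_pdivrMr ?ltr0n // mul1r ler_nat.
  by rewrite invr_gt0 invf_le1 ?ltr0n // ler1n D0.
apply: (@le_trans _ _ (mean (avg v (fun phi : {ffun H -> T} =>
    \prod_(u in F) U (phi u.1) (phi u.2) `^ w u)))).
  (* as U <= 1, each factor is at most its powers with exponent at most 1 *)
  rewrite mean_avg //; apply: le_mean => phi; apply: ler_prod => u uF; rewrite U0 /=.
  have /andP[w0 w1] := w01 u; have := U0 (phi u.1) (phi u.2).
  rewrite le_eqVlt => /orP[/eqP <-|U_gt0]; first by rewrite powR_ge0.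
  by rewrite -{1}[U _ _]powRr1 // ger_powR // U_gt0 U1.
pose W (u : H * H) (phi : {ffun H -> T}) := U (phi u.1) (phi u.2).
have Wdep u : depends_on (W u) [set u.1; u.2].
  by move=> phi psi e; rewrite /W !e // !inE eqxx ?orbT.
apply: (@le_trans _ _ (mean (fun phi => \prod_(u in F) avg v (W u) phi `^ w u))).
  apply: le_mean => phi.
  apply: (@avg_hoelder _ _ _ T0 _ (mem F) w W (fun u => [set u.1; u.2])).
  - by move=> u _; have /andP[] := w01 u.
  - by move=> u psi _; apply: U0.
  - by move=> u _; apply: Wdep.
  rewrite (bigD1 e0) /= ?e0F //.
  rewrite (eq_bigr (fun=> D%:R^-1)); last by move=> u /andP[_ /negbTE]; rewrite /w => ->.
  rewrite {1}/w eqxx sumr_const -[D%:R^-1 *+ _]mulr_natr [_^-1 * _]mulrC -mulrDl.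
  rewrite ler_pdivrMr ?ltr0n // mul1r -natrD ler_nat.
  apply: leq_trans vD; rewrite add2n ltnS (cardD1 e0 (incident F v)).
  rewrite inE e0F ve0 add1n ltnS; apply: eq_leq; apply: eq_card => u.
  by rewrite [RHS]inE /= inE andbC.
have avg_e0 phi : avg v (W e0) phi <= gamma.
  move: ve0 (edge_neq (fintype.subsetP FE _ e0F)); rewrite !inE /avg /W => /orP[]/eqP <- ne.
    apply: le_trans (Ug (phi e0.2)); apply: le_mean => t.
    by rewrite !ffunE eqxx eq_sym (negbTE ne) Usym.
  apply: le_trans (Ug (phi e0.1)); apply: le_mean => t.
  by rewrite !ffunE eqxx (negbTE ne).
have avg0 u phi : 0 <= avg v (W u) phi by apply: avg_ge0 => psi; apply: U0.
apply: (@le_trans _ _ (mean (fun phi =>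
   gamma `^ D%:R^-1 * \prod_(u in F) avg v (W u) phi `^ D%:R^-1))).
  apply: le_mean => phi; rewrite (bigD1 e0) //= [X in _ <= _ * X](bigD1 e0) //=.
  rewrite mulrA (eq_bigr (fun u => avg v (W u) phi `^ D%:R^-1)); last first.
    by move=> u /andP[_ /negbTE]; rewrite /w => ->.
  rewrite ler_wpM2r //; first by apply: prodr_ge0 => *; rewrite powR_ge0.
  rewrite /w eqxx mulr_natl mulr2n powRD; last first.
    by apply/implyP => /eqP h; move: Dinv0; rewrite -[X in 0 < X](addrK (D%:R^-1)) h; lra.
  rewrite ler_wpM2r ?powR_ge0 //.
  apply: ge0_ler_powR; rewrite ?nnegrE ?invr_ge0 ?ler0n //.
  exact: le_trans (avg_e0 phi).
rewrite meanZ ler_wpM2l ?powR_ge0 //.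
have := @finner R H T T0 (H * H)%type (mem F) (fun=> D%:R^-1)
  (fun u => avg v (W u)) (fun u => [set u.1; u.2]).
under [X in _ -> _ -> _ -> _ -> _ <= X]eq_bigr => u uF do
  rewrite (mean_avg T0) (mean_pair T0 U (edge_neq (fintype.subsetP FE _ uF))).
apply => //.
- move=> u _; apply: (depends_onS _ (depends_on_avg (v := v) (Wdep u))).
  by apply/fintype.subsetP => x; rewrite !inE => /andP[].
- by move=> x; apply: sum_weight.
Qed.

End EdgeFinner.

(** * Sets of edges in a graph of bounded degree *)

Section Combinatorics.
Variables (H : sgraph) (D : nat).
Implicit Types (F : {set H * H}) (S : {set H}).

(** Double counting of the pairs of an edge of [F] and an end of it in [S]. *)
Lemma sum_incident F S : F \subset edges H ->
  (\sum_(s in S) #|incident F s| = \sum_(u in F) ((u.1 \in S) + (u.2 \in S)))%N.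
Proof.
move=> FE.
have cnt s : #|incident F s| = (\sum_(u in F) ((u.1 == s) + (u.2 == s)))%N.
  rewrite -sum1_card (eq_bigl (fun u => (u \in F) && ((u.1 == s) || (u.2 == s)))).
    rewrite big_mkcondr /=; apply: eq_bigr => u uF.
    have := edge_neq (fintype.subsetP FE u uF).
    by case: (eqVneq u.1 s) => [->|_] /=; rewrite 1?eq_sym; [move/negbTE -> | case: eqP].
  by move=> u; exact: in_incident.
rewrite (eq_bigr _ (fun s _ => cnt s)) exchange_big /=; apply: eq_bigr => u _.
rewrite big_split /=.
have one x : (\sum_(s in S) (x == s) = (x \in S))%N.
  case xS: (x \in S).
    rewrite (bigD1 x) //= eqxx big1 // => s /andP[_]; rewrite eq_sym.
    by move/negbTE => ->.
  by rewrite big1 // => s sS; case: eqP => // e; rewrite -e xS in sS.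
by rewrite !one.
Qed.

Definition off F S := [set u in F | (u.1 \notin S) && (u.2 \notin S)].

Definition touching S := [set u in edges H | (u.1 \in S) || (u.2 \in S)].

(** The sets [S] that contribute to the independence polynomial of the star
    graph when [D] is the maximal degree, see [horner_star_poly]. *)
Definition saturated S := independent S && [forall x in S, deg x == D].

Hypothesis HD : maxdeg H = D.

(** Edges with both ends in [S] are counted twice on the right. *)
Lemma card_touching F S : F \subset edges H ->
  (#|F :\: off F S| + \sum_(u in F) ((u.1 \in S) && (u.2 \in S))
    = \sum_(s in S) #|incident F s|)%N.
Proof.
move=> FE; rewrite sum_incident //.
have -> : #|F :\: off F S| = (\sum_(u in F) ((u.1 \in S) || (u.2 \in S)))%N.
  rewrite -sum1_card (eq_bigl (fun u => (u \in F) && ((u.1 \in S) || (u.2 \in S)))).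
    by rewrite big_mkcondr /=; apply: eq_bigr => u uF; case: ifP.
  by move=> u; rewrite !inE; case: (u \in F) => //=; rewrite -negb_or negbK andbT.
by rewrite -big_split; apply: eq_bigr => u _; case: (_ \in S); case: (_ \in S).
Qed.

Lemma sum_incident_le F S : F \subset edges H ->
  (\sum_(s in S) #|incident F s| <= D * #|S|)%N.
Proof.
move=> FE; rewrite mulnC -sum_nat_const; apply: leq_sum => s _.
exact: incident_edges_le.
Qed.

Lemma card_touching_le F S : F \subset edges H -> (#|F :\: off F S| <= D * #|S|)%N.
Proof.
move=> FE; apply: leq_trans (sum_incident_le S FE).
by rewrite -card_touching // leq_addr.
Qed.

Lemma incident_full F v : F \subset edges H -> (#|incident F v| = D)%N ->
  incident F v = incident (edges H) v /\ deg v = D.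
Proof.
move=> FE e; have le := incident_edges_le v HD (subxx (edges H)).
have sub : incident F v \subset incident (edges H) v.
  apply/fintype.subsetP => u; rewrite !in_incident => /andP[uF ->].
  by rewrite (fintype.subsetP FE).
have ge := subset_leq_card sub; rewrite e in ge.
split; first by apply/eqP; rewrite eqEcard sub e.
by rewrite -card_incident; apply/eqP; rewrite eqn_leq le ge.
Qed.

(** When [card_touching_le] is an equality, no edge of [F] is counted twice in
    [card_touching] and every vertex of [S] is on [D] edges of [F]. *)
Lemma touching_saturated F S : F \subset edges H -> (#|F :\: off F S| = D * #|S|)%N ->
  saturated S /\ touching S \subset F.
Proof.
move=> FE e; have c := card_touching S FE; have l := sum_incident_le S FE.
move: (l); rewrite -c e -[X in (_ <= X)%N]addn0 leq_add2l leqn0 sum_nat_eq0 => /forallP noin.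
have full s : s \in S -> #|incident F s| = D.
  move=> sS; apply/eqP; rewrite eqn_leq incident_edges_le //= leqNgt; apply/negP => lt.
  suff : (\sum_(s in S) #|incident F s| < D * #|S|)%N by rewrite -c e ltnNge leq_addr.
  rewrite mulnC -sum_nat_const (bigD1 s) //= [X in (_ < X)%N](bigD1 s) //= -addSn.
  by apply: leq_add => //; apply: leq_sum => x _; apply: incident_edges_le.
have inF u s : s \in S -> u \in edges H -> (u.1 == s) || (u.2 == s) -> u \in F.
  move=> sS uE us; have [e1 _] := incident_full FE (full s sS).
  have : u \in incident F s by rewrite e1 in_incident uE.
  by rewrite in_incident => /andP[].
split; last first.
  apply/fintype.subsetP => u; rewrite inE => /andP[uE /orP[] h];
  by apply: inF uE _; first exact: h; rewrite eqxx ?orbT.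
apply/andP; split; last first.
  by apply/forall_inP => s sS; have [_ ->] := incident_full FE (full s sS).
apply/forall_inP => x xS; apply/forall_inP => y yS; apply/negP => /adj_edge /orP[] uE.
  by have := noin (x, y); rewrite (inF _ x) ?eqxx //= xS yS.
by have := noin (y, x); rewrite (inF _ x) ?eqxx ?orbT //= xS yS.
Qed.

Lemma saturated_touching S : saturated S -> (#|touching S| = D * #|S|)%N.
Proof.
move=> /andP[/forall_inP ind /forall_inP dS].
have tE : touching S \subset edges H by apply/fintype.subsetP => u; rewrite inE => /andP[].
have := card_touching S tE.
rewrite [X in (_ + X)%N]big1 => [|u]; last first.
  rewrite inE => /andP[uE _]; case xS: (u.1 \in S); case yS: (u.2 \in S) => //=.
  by have /forall_inP/(_ _ yS) := ind _ xS; rewrite (edge_adj uE).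
rewrite addn0.
have -> : off (touching S) S = finset.set0.
  by apply/setP => u; rewrite !inE -negb_or -andbA andbN andbF.
rewrite finset.setD0 => ->; rewrite mulnC -sum_nat_const; apply: eq_bigr => s sS.
have <- : deg s = D by apply/eqP/dS.
rewrite -card_incident; apply: eq_card => u; rewrite !in_incident inE.
by case: (u \in _) => //=; case: (eqVneq u.1 s) => [->|_] /=;
   [rewrite sS|case: eqP => [->|]; rewrite ?andbF ?sS ?orbT].
Qed.

Hypothesis Hconn : connected_graph H.

(** A vertex on [D] edges of [F] has all its edges in [F], so its neighbours are
    on an edge of [F] too, hence again on [D] of them; connectedness spreads
    this to the whole graph. *)
Lemma full_component F : F \subset edges H -> F != finset.set0 ->
  (forall v, ~~ (0 < #|incident F v| < D)%N) ->
  F = edges H /\ regular H D.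
Proof.
move=> FE /set0Pn[u0 u0F] nodef.
have deg_in v : (0 < #|incident F v|)%N -> #|incident F v| = D.
  move=> v0; apply/eqP; rewrite eqn_leq incident_edges_le //= leqNgt.
  by apply: contra (nodef v) => ->; rewrite v0.
have inc_pos u v : u \in F -> (u.1 == v) || (u.2 == v) -> (0 < #|incident F v|)%N.
  by move=> uF uv; apply/card_gt0P; exists u; rewrite in_incident uF.
have step x y : (0 < #|incident F x|)%N -> adj x y -> (0 < #|incident F y|)%N.
  move=> /deg_in /(incident_full FE)[e _] /adj_edge /orP[] uE.
    have : (x, y) \in incident F x by rewrite e in_incident uE eqxx.
    by rewrite in_incident => /andP[uF _]; apply: inc_pos uF _; rewrite eqxx orbT.
  have : (y, x) \in incident F x by rewrite e in_incident uE eqxx orbT.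
  by rewrite in_incident => /andP[uF _]; apply: inc_pos uF _; rewrite eqxx.
have all_pos y : (0 < #|incident F y|)%N.
  have [_ /(_ u0.1 y) /connectP[s sp ->]] := Hconn.
  have : (0 < #|incident F u0.1|)%N by apply: inc_pos u0F _; rewrite eqxx.
  elim: s u0.1 sp => //= z s IH x /andP[xz zs] x0.
  by apply: IH => //; apply: step xz.
split; last by move=> x; have [_ ->] := incident_full FE (deg_in x (all_pos x)).
apply/eqP; rewrite finset.eqEsubset FE; apply/fintype.subsetP => u uE.
have [e _] := incident_full FE (deg_in u.1 (all_pos u.1)).
have : u \in incident F u.1 by rewrite e in_incident uE eqxx.
by rewrite in_incident => /andP[].
Qed.

Lemma regular_handshake : regular H D -> (2 * #|edges H| = D * #|H|)%N.
Proof.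
move=> reg; have := sum_incident [set: H]%SET (subxx (edges H)).
rewrite (eq_bigr (fun=> D)); last by move=> x _; rewrite card_incident reg.
rewrite sum_nat_const cardsT mulnC => ->.
rewrite (eq_bigr (fun=> 2%N)); last by move=> u _; rewrite !inE.
by rewrite sum_nat_const mulnC.
Qed.

End Combinatorics.

(** * Homomorphism densities of perturbed constant weights *)

Lemma prod_1D (R : comPzRingType) (I : finType) (A : {set I}) (x : I -> R) :
  \prod_(i in A) (1 + x i) = \sum_(F : {set I} | F \subset A) \prod_(i in F) x i.
Proof.
rewrite big_mkcond /= (eq_bigr (fun i => (if i \in A then x i else 0) + 1)); last first.
  by move=> i _; case: (i \in A); rewrite ?add0r // addrC.
rewrite bigA_distr (bigID (fun F : {set I} => F \subset A)) /=.
rewrite [X in _ + X]big1 ?addr0 => [|F]; last first.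
  case/fintype.subsetPn => i iF /negbTE iA.
  by rewrite (bigD1 i) //= iF iA mul0r.
apply: eq_big => // F FA; rewrite [RHS]big_mkcond; apply: eq_bigr => i _.
by case: ifP => // iF; rewrite (fintype.subsetP FA _ iF).
Qed.

(** Both terms are at most the larger one. *)
Lemma exprD_le (R : realDomainType) (x y : R) n :
  0 <= x -> 0 <= y -> (x + y) ^+ n <= 2 ^+ n * (x ^+ n + y ^+ n).
Proof.
move=> x0 y0; wlog xy : x y x0 y0 / x <= y.
  by case/orP: (le_total x y) => xy h; [|rewrite addrC [X in _ * X]addrC]; apply: h.
apply: (@le_trans _ _ ((2 * y) ^+ n)).
  by apply: lerXn2r; rewrite ?nnegrE ?addr_ge0 ?mulr_ge0 //; lra.
by rewrite exprMn ler_wpM2l ?exprn_ge0 // lerDr exprn_ge0.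
Qed.

Section Density.
Variables (R : realType) (T : finType) (H : sgraph) (D : nat).
Hypothesis T0 : (0 < #|T|)%N.
Hypothesis D0 : (0 < D)%N.
Hypothesis HD : maxdeg H = D.
Local Notation E := (edges H).

Definition dens (g : T -> T -> R) : R :=
  mean (fun phi : {ffun H -> T} => \prod_(u in E) g (phi u.1) (phi u.2)).

Lemma powR_root_le (x : R) : 1 <= x -> x `^ D%:R^-1 <= x.
Proof.
move=> x1; rewrite -[leRHS]powRr1; last lra.
by apply: ler_powR => //; rewrite invf_le1 ?ltr0n // ler1n.
Qed.

(** By [le_prodD] the difference is a sum of densities in which one edge carries
    [b]; Finner's inequality makes each of them small if [b] is small in the
    norm of order [D]. This removes small entries of a weight, and later its
    diagonal. *)
Lemma dens_perturb (a b : T -> T -> R) (K eta : R) :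
  (forall x y, 0 <= a x y) -> (forall x y, 0 <= b x y) -> 1 <= K ->
  mean2 (fun x y => (a x y + b x y) ^+ D) <= K ->
  mean2 (fun x y => b x y ^+ D) <= eta ->
  dens (fun x y => a x y + b x y) <=
  dens a + #|E|%:R * (eta `^ D%:R^-1 * K ^+ #|E|).
Proof.
move=> a0 b0 K1 hK heta; rewrite /dens.
apply: (@le_trans _ _ (mean (fun phi : {ffun H -> T} =>
   \prod_(u in E) a (phi u.1) (phi u.2) +
   \sum_(u in E) b (phi u.1) (phi u.2) *
     \prod_(w in E :\ u) (a (phi w.1) (phi w.2) + b (phi w.1) (phi w.2))))).
  apply: le_mean => phi.
  by apply: (@le_prodD R _ E (fun u => a (phi u.1) (phi u.2))
                        (fun u => b (phi u.1) (phi u.2))).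
rewrite meanD lerD2l mean_sum mulr_natl -sumr_const; apply: ler_sum => u uE.
pose g w x y := if w == u then b x y else a x y + b x y.
pose c w := if w == u then eta else K.
have h : mean (fun phi : {ffun H -> T} => \prod_(w in E) g w (phi w.1) (phi w.2)) <=
    \prod_(w in E) c w `^ D%:R^-1.
  apply: edge_finner_le => //.
  - by move=> v; apply: incident_edges_le.
  - by move=> w x y; rewrite /g; case: ifP => // _; apply: addr_ge0.
  - by move=> w wE; rewrite /g /c; case: ifP.
have -> : mean (fun phi : {ffun H -> T} => b (phi u.1) (phi u.2) *
    \prod_(w in E :\ u) (a (phi w.1) (phi w.2) + b (phi w.1) (phi w.2))) =
    mean (fun phi : {ffun H -> T} => \prod_(w in E) g w (phi w.1) (phi w.2)).
  apply: eq_mean => phi; rewrite (big_setD1 u uE) /= {1}/g eqxx; congr (_ * _).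
  by apply: eq_bigr => w; rewrite !inE /g => /andP[/negbTE ->].
apply: le_trans h _; rewrite (big_setD1 u uE) /= {1}/c eqxx ler_wpM2l ?powR_ge0 //.
rewrite (eq_bigr (fun=> K `^ D%:R^-1)) => [|w]; last first.
  by rewrite !inE /c => /andP[/negbTE ->].
rewrite prodr_const (cardsD1 u E) uE.
apply: (@le_trans _ _ (K ^+ #|E :\ u|)).
  by apply: lerXn2r; rewrite ?nnegrE ?powR_ge0 ?powR_root_le //; lra.
by rewrite exprD expr1 ler_peMl // exprn_ge0 //; lra.
Qed.

Hypothesis Hconn : connected_graph H.
Variables (p C Dc gamma : R) (U : T -> T -> R) (B : {set T}).
Hypothesis p01 : 0 < p < 1.
Hypothesis C1 : 1 <= C.
Hypothesis Dc1 : 1 <= Dc.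
Hypothesis U01 : forall x y, 0 <= U x y <= 1.
Hypothesis Usym : forall x y, U x y = U y x.
Hypothesis Umean : mean2 U <= C * p ^+ D.
Hypothesis Bmean : mean (fun x => (x \in B)%:R) <= Dc * p ^+ D.

Definition bulk x y : R := if (x \notin B) && (y \notin B) then U x y else 0.

Hypothesis Ubulk : forall x, mean (bulk x) <= gamma.

(** Entries of weight 1 at a fraction [x p^D] of the rows have [hub_mass] near
   [x]; a clique on a fraction [y p^(D/2)] of the vertices has [bulk_mass] [y^2]. *)
Definition hub_mass : R := p ^- D * mean2 (fun x y => U x y * (x \in B)%:R).
Definition bulk_mass : R := p ^- D * mean2 bulk.

Let p0 : 0 < p. Proof. by case/andP: p01. Qed.
Let C0 : 0 <= C. Proof. exact: le_trans ler01 C1. Qed.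
Let Dc0 : 0 <= Dc. Proof. exact: le_trans ler01 Dc1. Qed.
Let U0 x y : 0 <= U x y. Proof. by case/andP: (U01 x y). Qed.
Let U1 x y : U x y <= 1. Proof. by case/andP: (U01 x y). Qed.

Lemma bulk01 x y : 0 <= bulk x y <= 1.
Proof. by rewrite /bulk; case: ifP; rewrite ?U01 // lexx ler01. Qed.

Lemma bulk_le x y : bulk x y <= U x y.
Proof. by rewrite /bulk; case: ifP. Qed.

Lemma bulk_sym x y : bulk x y = bulk y x.
Proof. by rewrite /bulk andbC Usym. Qed.

Lemma mean2_bulk_le : mean2 bulk <= C * p ^+ D.
Proof. by apply: le_trans Umean; apply: le_mean2 => x y; apply: bulk_le. Qed.

Lemma hub_mass_ge0 : 0 <= hub_mass.
Proof.
by rewrite mulr_ge0 ?invr_ge0 ?exprn_ge0 ?(ltW p0) // mean2_ge0 // => x y; rewrite mulr_ge0.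
Qed.

Lemma bulk_mass_ge0 : 0 <= bulk_mass.
Proof.
rewrite mulr_ge0 ?invr_ge0 ?exprn_ge0 ?(ltW p0) // mean2_ge0 // => x y.
by case/andP: (bulk01 x y).
Qed.

Definition hubs_of (phi : {ffun H -> T}) : {set H} := [set v | phi v \in B].

(** The contribution, to the expansion of the density of [1 + U / p], of choosing
    [U / p] exactly on [F] and of the maps sending exactly [S] to hubs. *)
Definition term (F : {set H * H}) (S : {set H}) : R :=
  mean (fun phi : {ffun H -> T} =>
    (hubs_of phi == S)%:R * \prod_(u in F) (U (phi u.1) (phi u.2) / p)).

Lemma prod_divp (F : {set H * H}) (g : T -> T -> R) (phi : {ffun H -> T}) :
  \prod_(u in F) (g (phi u.1) (phi u.2) / p) =
  p ^- #|F| * \prod_(u in F) g (phi u.1) (phi u.2).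
Proof. by rewrite big_split /= prodr_const mulrC exprVn. Qed.

(** Edges touching [S] are bounded by 1, so that the vertices of [S] become
    independent of the others and each contributes the fraction of hubs. *)
Lemma term_le_split F S : term F S <=
  p ^- #|F| * ((Dc * p ^+ D) ^+ #|S| *
    mean (fun phi : {ffun H -> T} => \prod_(u in off F S) bulk (phi u.1) (phi u.2))).
Proof.
have bulk0 x y : 0 <= bulk x y by case/andP: (bulk01 x y).
pose f (phi : {ffun H -> T}) : R := \prod_(s in S) (phi s \in B)%:R.
pose g (phi : {ffun H -> T}) : R := \prod_(u in off F S) bulk (phi u.1) (phi u.2).
apply: (@le_trans _ _ (mean (fun phi => p ^- #|F| * (f phi * g phi)))).
  apply: le_mean => phi; rewrite prod_divp mulrCA.
  rewrite ler_wpM2l ?invr_ge0 ?exprn_ge0 ?(ltW p0) //.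
  case: eqP => [hS|_]; last by rewrite mul0r mulr_ge0 // prodr_ge0.
  have -> : f phi = 1.
    by rewrite /f big1 // => s; rewrite -hS inE => ->.
  rewrite !mul1r /g (big_setID (off F S)) /=.
  have -> : F :&: off F S = off F S by apply/setP => u; rewrite !inE; case: (u \in F).
  rewrite -[leRHS]mulr1; apply: ler_pM; rewrite ?prodr_ge0 //.
    apply: ler_prod => u; rewrite inE -hS !inE => /andP[_ h].
    by rewrite U0 /= /bulk h.
  by apply: prodr_ile1 => u _; apply: U01.
rewrite meanZ ler_wpM2l ?invr_ge0 ?exprn_ge0 ?(ltW p0) //.
apply: (@le_trans _ _ (mean f * mean g)).
  apply: (mean_indep T0 (D := S)).
  - by move=> phi; rewrite prodr_ge0.
  - by move=> phi; rewrite prodr_ge0.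
  - by move=> phi psi e; apply: eq_bigr => s sS; rewrite e.
  - move=> phi psi e; apply: eq_bigr => u; rewrite inE => /andP[_ /andP[u1 u2]].
    by rewrite !e // inE.
rewrite ler_wpM2r ?mean_ge0 // => [phi|]; first by rewrite prodr_ge0.
pose b v (x : T) : R := if v \in S then (x \in B)%:R else 1.
have -> : mean f = mean (fun phi : {ffun H -> T} => \prod_v b v (phi v)).
  by apply: eq_mean => phi; rewrite /f big_mkcond; apply: eq_bigr => v _.
rewrite mean_prod -prodr_const [leRHS]big_mkcond /=.
apply: ler_prod => v _; rewrite mean_ge0 => [|x]; last by rewrite /b; case: ifP.
by rewrite /b; case: (v \in S) => /=; [exact: Bmean|rewrite mean_cst].
Qed.

Lemma mean2_powD (g : T -> T -> R) (K : R) : (forall x y, 0 <= g x y <= 1) ->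
  mean2 g <= K -> mean2 (fun x y => g x y ^+ D) <= K.
Proof.
move=> g01; apply: le_trans; apply: le_mean2 => x y; have /andP[g0 g1] := g01 x y.
by rewrite -[leRHS]expr1 ler_wiXn2l.
Qed.

Lemma root_Cp : (C * p ^+ D) `^ D%:R^-1 <= C * p.
Proof.

rewrite powRM // ?exprn_ge0 ?(ltW p0) // powR_root ?(ltW p0) //.
by rewrite ler_wpM2r ?(ltW p0) // powR_root_le.
Qed.

Lemma off_sub (F : {set H * H}) S : off F S \subset F.
Proof. by apply/fintype.subsetP => u; rewrite inE => /andP[]. Qed.

(** Collects the powers of [p] in [term_le_split]. *)
Lemma term_le_off (F : {set H * H}) S (M : R) : F \subset E -> 0 <= M ->
  mean (fun phi : {ffun H -> T} => \prod_(u in off F S) bulk (phi u.1) (phi u.2))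
    <= M * p ^+ #|off F S| ->
  term F S <= Dc ^+ #|H| * M * p ^+ (D * #|S| - #|F :\: off F S|).
Proof.
move=> FE M0 h; apply: le_trans (term_le_split F S) _.
have le := card_touching_le HD S FE.
have -> : #|F| = (#|F :\: off F S| + #|off F S|)%N.
  rewrite -(cardsID (off F S) F) addnC; congr (_ + #|pred_of_set _|)%N.
  by apply/finset.setIidPr; apply: off_sub.
set m := #|F :\: _| in le *; set e := #|off F S| in h *.
apply: (@le_trans _ _ (p ^- (m + e) * ((Dc * p ^+ D) ^+ #|S| * (M * p ^+ e)))).
  rewrite ler_wpM2l ?invr_ge0 ?exprn_ge0 ?(ltW p0) // ler_wpM2l // exprn_ge0 // mulr_ge0 //.
  by rewrite exprn_ge0 // ltW.
have -> : p ^- (m + e) * ((Dc * p ^+ D) ^+ #|S| * (M * p ^+ e)) =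
   Dc ^+ #|S| * M * p ^+ (D * #|S| - m).
  have pn0 k : p ^+ k != 0 by rewrite expf_neq0 // gt_eqF.
  rewrite !exprMn -exprM -{1}(subnK le) !exprD.
  by field; rewrite !pn0.
have S_le : (#|S| <= #|H|)%N by apply: max_card.
rewrite ler_wpM2r ?exprn_ge0 ?(ltW p0) // ler_wpM2r // .
exact: ler_weXn2l.
Qed.

Lemma bulk_finner (F : {set H * H}) : F \subset E ->
  mean (fun phi : {ffun H -> T} => \prod_(u in F) bulk (phi u.1) (phi u.2))
    <= C ^+ #|E| * p ^+ #|F|.
Proof.
move=> FE; have e_le : (#|F| <= #|E|)%N by apply: subset_leq_card.
apply: (@le_trans _ _ (\prod_(u in F) (C * p ^+ D) `^ D%:R^-1)).
  apply: (edge_finner_le T0 D0 (g := fun=> bulk)) => //.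
  - by move=> v; apply: incident_edges_le.
  - by move=> _ x y; case/andP: (bulk01 x y).
  - by move=> _ _; apply: mean2_powD; [exact: bulk01|exact: mean2_bulk_le].
rewrite prodr_const; apply: (@le_trans _ _ ((C * p) ^+ #|F|)).
  by apply: lerXn2r; rewrite ?nnegrE ?powR_ge0 ?root_Cp // mulr_ge0 ?(ltW p0).
rewrite exprMn ler_wpM2r ?exprn_ge0 ?(ltW p0) //; exact: ler_weXn2l.
Qed.

(** Bounds all negligible terms: small once [p] and [gamma] are small in terms of
    [C] and [Dc]. *)
Definition slack : R := Dc ^+ #|H| * C ^+ #|E| * (p + gamma `^ D%:R^-1).

(** The deficit in the number of edges touching [S] leaves a positive power of [p]. *)
Lemma term_le_hubs (F : {set H * H}) S :
  F \subset E -> (#|F :\: off F S| < D * #|S|)%N -> term F S <= slack.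
Proof.
move=> FE lt; have offE := fintype.subset_trans (off_sub F S) FE.
apply: le_trans (term_le_off FE _ (bulk_finner offE)) _; first exact: exprn_ge0.
rewrite /slack ler_wpM2l ?mulr_ge0 ?exprn_ge0 //.
apply: (@le_trans _ _ p); last by rewrite lerDl powR_ge0.
rewrite -[leRHS]expr1; case/andP: p01 => _ p1; apply: ler_wiXn2l; rewrite ?ltW //.
by rewrite subn_gt0.
Qed.

Lemma term_le_deficient (F : {set H * H}) S v :
  F \subset E -> (0 < #|incident (off F S) v| < D)%N -> term F S <= slack.
Proof.
move=> FE vdef; have offE := fintype.subset_trans (off_sub F S) FE.
have e_le : (#|off F S| <= #|E|)%N by apply: subset_leq_card.
have h : mean (fun phi : {ffun H -> T} => \prod_(u in off F S) bulk (phi u.1) (phi u.2))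
    <= (gamma `^ D%:R^-1 * C ^+ #|E|) * p ^+ #|off F S|.
  apply: le_trans (edge_finner_deficient T0 D0 offE _ vdef bulk01 bulk_sym Ubulk) _.
    by move=> x; apply: incident_edges_le.
  rewrite -mulrA ler_wpM2l ?powR_ge0 // prodr_const.
  apply: (@le_trans _ _ ((C * p) ^+ #|off F S|)).
    apply: lerXn2r; rewrite ?nnegrE ?powR_ge0 ?mulr_ge0 ?(ltW p0) //.
    apply: le_trans root_Cp; apply: ge0_ler_powR; rewrite ?nnegrE ?invr_ge0 ?ler0n //.
    - by apply: mean2_ge0 => x y; case/andP: (bulk01 x y).
    - by rewrite mulr_ge0 ?exprn_ge0 ?(ltW p0).
    - exact: mean2_bulk_le.
  rewrite exprMn ler_wpM2r ?exprn_ge0 ?(ltW p0) //; exact: ler_weXn2l.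
apply: le_trans (term_le_off FE _ h) _; first by rewrite mulr_ge0 ?powR_ge0 ?exprn_ge0.
apply: (@le_trans _ _ (Dc ^+ #|H| * (gamma `^ D%:R^-1 * C ^+ #|E|))).
  case/andP: p01 => _ p1; rewrite ler_piMr ?exprn_ile1 ?(ltW p0) ?(ltW p1) //.
  by rewrite !mulr_ge0 ?powR_ge0 ?exprn_ge0.
rewrite /slack -mulrA [gamma `^ _ * _]mulrC !ler_wpM2l ?exprn_ge0 //.
by rewrite lerDr (ltW p0).
Qed.

(** Each edge touching [S] carries [U / p] restricted to rows (or columns) of
    hubs, according to which end is in [S]; there are [D * #|S|] such edges. *)
Lemma term_le_saturated S : saturated D S -> term (touching S) S <= hub_mass ^+ #|S|.
Proof.
move=> satS; have tE : touching S \subset E.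
  by apply/fintype.subsetP => u; rewrite inE => /andP[].
pose g (u : H * H) x y := U x y / p * ((if u.1 \in S then x else y) \in B)%:R.
have g0 u x y : 0 <= g u x y by rewrite /g mulr_ge0 // divr_ge0 // ltW.
apply: (@le_trans _ _ (mean (fun phi : {ffun H -> T} =>
    \prod_(u in touching S) g u (phi u.1) (phi u.2)))).
  apply: le_mean => phi; case: eqP => [hS|_]; last by rewrite mul0r prodr_ge0.
  rewrite mul1r; apply: ler_prod => u; rewrite inE => /andP[_ uS].
  rewrite divr_ge0 ?(ltW p0) //= /g.
  have -> : (if u.1 \in S then phi u.1 else phi u.2) \in B.
    by move: uS; rewrite -hS !inE; case: ifP.
  by rewrite mulr1.
apply: (@le_trans _ _ (\prod_(u in touching S) hub_mass `^ D%:R^-1)).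
  apply: edge_finner_le => // [v|u _]; first exact: incident_edges_le.
  apply: (@le_trans _ _ (mean2 (fun x y => p ^- D * (U x y *
     ((if u.1 \in S then x else y) \in B)%:R)))).
    apply: le_mean2 => x y; rewrite /g !exprMn exprVn mulrAC mulrC.
    rewrite ler_wpM2l ?invr_ge0 ?exprn_ge0 ?(ltW p0) //.
    rewrite -exprMn; case: (_ \in B); rewrite ?mulr1 ?mulr0 ?expr0n ?gtn_eqF //.
    by rewrite -[leRHS]expr1 ler_wiXn2l.
  rewrite mean2Z /hub_mass; case: (u.1 \in S) => //.
  rewrite le_eqVlt; apply/orP; left; apply/eqP; congr (_ * _).
  rewrite /mean2 mean_exchange; apply: eq_mean => x; apply: eq_mean => y.
  by rewrite Usym.
rewrite prodr_const (saturated_touching satS) exprM -[_ `^ _ ^+ D]powR_mulrn ?powR_ge0 //.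
rewrite -powRrM mulVf ?powRr1 ?hub_mass_ge0 //.
by rewrite pnatr_eq0 -lt0n.
Qed.

(** A regular graph has [D * #|H| / 2] edges, whence the exponent. *)
Lemma term_le_full : regular H D ->
  term E finset.set0 <= (bulk_mass `^ 2^-1) ^+ #|H|.
Proof.
move=> reg.
have g0 x y : 0 <= bulk x y / p.
  by case/andP: (bulk01 x y) => b0 _; rewrite divr_ge0 // ltW.
apply: (@le_trans _ _ (mean (fun phi : {ffun H -> T} =>
    \prod_(u in E) (bulk (phi u.1) (phi u.2) / p)))).
  apply: le_mean => phi; case: eqP => [hS|_]; last by rewrite mul0r prodr_ge0.
  rewrite mul1r; apply: ler_prod => u _; rewrite divr_ge0 ?(ltW p0) //=.
  rewrite /bulk; have nB v : phi v \notin B.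
    by apply/negP => vB; have : v \in hubs_of phi; [rewrite inE|rewrite hS inE].
  by rewrite !nB.
apply: (@le_trans _ _ (\prod_(u in E) bulk_mass `^ D%:R^-1)).
  apply: (edge_finner_le T0 D0 (g := fun=> fun x y => bulk x y / p)) => //.
    by move=> v; apply: incident_edges_le.
  move=> _ _; rewrite /bulk_mass -mean2Z; apply: le_mean2 => x y.
  rewrite exprMn exprVn mulrC ler_wpM2l ?invr_ge0 ?exprn_ge0 ?(ltW p0) //.
  by case/andP: (bulk01 x y) => b0 b1; rewrite -[leRHS]expr1 ler_wiXn2l.
rewrite prodr_const -!powR_mulrn ?powR_ge0 // -!powRrM.
suff -> : D%:R^-1 * #|E|%:R = 2^-1 * #|H|%:R :> R by [].
have /(congr1 (fun n => n%:R : R)) := regular_handshake reg; rewrite !natrM => h.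
have Dn0 : D%:R != 0 :> R by rewrite pnatr_eq0 -lt0n.
by apply: (mulfI Dn0); apply: (@mulfI _ 2) => //; field: h.
Qed.

Lemma slack_ge0 : 0 <= slack.
Proof. by rewrite !mulr_ge0 ?exprn_ge0 ?addr_ge0 ?powR_ge0 ?(ltW p0). Qed.

Variable b : bool.
Hypothesis Hb : regular H D <-> b.

(** Only two kinds of pairs are not negligible: the edges at a saturated set,
    and all edges of a regular graph with no vertex sent to a hub. *)
Lemma term_le (F : {set H * H}) S : F \subset E ->
  term F S <= ((F == touching S) && saturated D S)%:R * hub_mass ^+ #|S| +
    ((F == E) && (S == finset.set0))%:R * (b%:R * (bulk_mass `^ 2^-1) ^+ #|H|) + slack.
Proof.
move=> FE.
have A0 (c : bool) : 0 <= c%:R * hub_mass ^+ #|S|.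
  by rewrite mulr_ge0 // exprn_ge0 // hub_mass_ge0.
have B0 (c : bool) : 0 <= c%:R * (b%:R * (bulk_mass `^ 2^-1) ^+ #|H|).
  by rewrite !mulr_ge0 // exprn_ge0 // powR_ge0.
have [lt|ge] := ltnP #|F :\: off F S| (D * #|S|).
  by apply: le_trans (term_le_hubs FE lt) _; rewrite lerDr addr_ge0.
have e : #|F :\: off F S| = (D * #|S|)%N.
  by apply/eqP; rewrite eqn_leq ge card_touching_le.
have [satS tF] := touching_saturated HD FE e.
have [off0|offn0] := eqVneq (off F S) finset.set0.
  have -> : F = touching S.
    apply/eqP; rewrite finset.eqEsubset tF andbT; apply/fintype.subsetP => u uF.
    rewrite inE (fintype.subsetP FE) //=; have : u \notin off F S by rewrite off0 inE.
    by rewrite inE uF /= -negb_or negbK.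
  rewrite eqxx satS mul1r; apply: le_trans (term_le_saturated satS) _.
  by rewrite -addrA lerDl addr_ge0 ?slack_ge0.
have offE := fintype.subset_trans (off_sub F S) FE.
case: (boolP [exists v, 0 < #|incident (off F S) v| < D]%N) => [/existsP[v vdef]|].
  by apply: le_trans (term_le_deficient FE vdef) _; rewrite lerDr addr_ge0.
rewrite negb_exists => /forallP nodef.
have [offEq reg] := full_component HD Hconn offE offn0 nodef.
have FEq : F = E by apply/eqP; rewrite finset.eqEsubset FE -offEq off_sub.
have S0 : S = finset.set0.
  apply/setP => s; rewrite [RHS]inE; apply/negP => sS.
  have : (0 < #|incident E s|)%N by rewrite card_incident reg.
  case/card_gt0P => u; rewrite in_incident -offEq inE => /andP[/andP[_ /andP[u1 u2]]].
  by case/orP => /eqP us; move: u1 u2; rewrite us sS.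
rewrite FEq S0 !eqxx mul1r (proj1 Hb reg) mul1r.
apply: le_trans (term_le_full reg) _.
rewrite addrAC lerDr addr_ge0 ?slack_ge0 //.
by rewrite mulr_ge0 // exprn_ge0 // hub_mass_ge0.
Qed.

Lemma dens_le_masses :
  dens (fun x y => 1 + U x y / p) <=
  \sum_(S : {set H} | saturated D S) hub_mass ^+ #|S| +
  b%:R * (bulk_mass `^ 2^-1) ^+ #|H| +
  (#|{set H * H}| * #|{set H}|)%:R * slack.
Proof.
have -> : dens (fun x y => 1 + U x y / p) =
    \sum_(F : {set H * H} | F \subset E) \sum_(S : {set H}) term F S.
  rewrite /dens /term.
  rewrite (eq_mean (g := fun phi : {ffun H -> T} =>
    \sum_(F : {set H * H} | F \subset E) \sum_(S : {set H})
      (hubs_of phi == S)%:R * \prod_(u in F) (U (phi u.1) (phi u.2) / p))).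
    by rewrite mean_sum; apply: eq_bigr => F _; rewrite mean_sum.
  move=> phi; rewrite prod_1D; apply: eq_bigr => F _.
  rewrite (bigD1 (hubs_of phi)) //= eqxx mul1r [X in _ + X]big1 ?addr0 // => S.
  by rewrite eq_sym => /negbTE ->; rewrite mul0r.
apply: le_trans (ler_sum _ (fun F FE => ler_sum _ (fun S _ => term_le S FE))) _.
under eq_bigr do rewrite 2!big_split /=.
rewrite 2!big_split /= -!addrA; apply: lerD; last apply: lerD.
- rewrite exchange_big /= [leRHS]big_mkcond /=; apply: ler_sum => S _.
  rewrite (bigD1 (touching S)) /= => [|]; last first.
    by apply/fintype.subsetP => u; rewrite inE => /andP[].
  rewrite eqxx big1 => [|F /andP[_ /negbTE ->]]; last by rewrite mul0r.
  by rewrite addr0; case: ifP => _; rewrite ?mul1r ?mul0r.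
- rewrite (bigD1 E) //= [X in _ + X]big1 => [|F /andP[_ /negbTE FE]]; last first.
    by rewrite big1 // => S _; rewrite FE mul0r.
  rewrite (bigD1 finset.set0) //= !eqxx mul1r big1 ?addr0 // => S /negbTE ->.
  by rewrite andbF mul0r.
- under eq_bigr do rewrite sumr_const.
  rewrite sumr_const -mulrnA -[slack *+ _]mulr_natl ler_wpM2r ?slack_ge0 // ler_nat mulnC.
  by rewrite leq_mul // max_card.
Qed.

End Density.

Section StarPolynomial.
Variables (R : realType) (H : sgraph).

Lemma horner_indep_poly (G : sgraph) (x : R) :
  (indep_poly G R).[x] = \sum_(S : {set G} | independent S) x ^+ #|S|.
Proof. by rewrite /indep_poly horner_sum; apply: eq_bigr => S _; rewrite hornerXn. Qed.

(** Independent sets of the star graph are the saturated sets of the graph. *)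
Lemma horner_star_poly (x : R) :
  (indep_poly (star H) R).[x] =
  \sum_(S : {set H} | saturated (maxdeg H) S) x ^+ #|S|.
Proof.
rewrite horner_indep_poly.
pose h (S : {set star H}) : {set H} := [set val x | x in S].
pose h' (S : {set H}) : {set star H} := [set x | val x \in S].
rewrite [RHS](reindex_onto h h') => [|S /andP[_ /forall_inP dS]]; last first.
  apply/setP => y; apply/imsetP/idP => [[z]|yS]; first by rewrite inE => zS ->.
  have yd : y \in [set x : H | deg x == maxdeg H] by rewrite inE dS.
  by exists (Sub y yd); rewrite ?inE.
have hK S : h' (h S) = S.
  apply/setP => z; rewrite inE; apply/imsetP/idP => [[w wS /val_inj -> //]|zS].
  by exists z.
apply: eq_big => [S|S _]; last by rewrite card_imset //; exact: val_inj.
rewrite hK eqxx andbT; apply/forall_inP/andP => [ind|[/forall_inP ind _] y yS].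
  split; apply/forall_inP => _ /imsetP[y yS ->].
    apply/forall_inP => _ /imsetP[z zS ->].
    by have /forall_inP/(_ _ zS) := ind _ yS.
  by have := valP y; rewrite inE.
apply/forall_inP => z zS.
have /forall_inP := ind _ (imset_f val yS).
by move/(_ _ (imset_f val zS)).
Qed.

(** The linear coefficient is at least 1, since some vertex attains the maximal
    degree. This turns nearly feasible points into feasible ones. *)
Lemma star_poly_growth (x t : R) : (0 < #|H|)%N -> 0 <= x -> 0 <= t ->
  (indep_poly (star H) R).[x] + t <= (indep_poly (star H) R).[x + t].
Proof.
move=> H0 x0 t0; rewrite !horner_star_poly.
have [v vD] : exists v : H, deg v = maxdeg H.
  by have [v e] := @bigop.eq_bigmax H (@deg H) H0; exists v; rewrite /maxdeg e.
have sv : saturated (maxdeg H) [set v]%SET.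
  apply/andP; split; apply/forall_inP => y; rewrite inE => /eqP ->; last by rewrite vD.
  by apply/forall_inP => z; rewrite inE => /eqP ->; rewrite adj_irr.
rewrite (bigD1 [set v]%SET sv) /= [leRHS](bigD1 [set v]%SET sv) /= cards1 !expr1.
rewrite addrAC lerD2l; apply: ler_sum => S _.
by apply: lerXn2r; rewrite ?nnegrE ?addr_ge0 // lerDl.
Qed.

End StarPolynomial.

Section DensityUpper.
Variables (R : realType) (T : finType).
Hypothesis T0 : (0 < #|T|)%N.

(** Bounds the mean of [(1 + (U + V) / p)^D] when those of [(U / p)^D] and
    [(V / p)^D] are at most [C] and 1: apply [exprD_le] twice. *)
Definition perturb_const (D : nat) (C : R) : R := 2 ^+ D * (1 + 2 ^+ D * (C + 1)).

(** [U] is the part of the excess over [p] that matters, [V] the part that is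
    thrown away by [dens_perturb]. *)
Lemma dens_upper (H : sgraph) (D : nat) (p C Dc gamma eta : R) (U V : T -> T -> R)
    (B : {set T}) (b : bool) :
  (0 < D)%N -> maxdeg H = D -> connected_graph H -> (regular H D <-> b) ->
  0 < p < 1 -> 1 <= C -> 1 <= Dc -> eta <= 1 ->
  (forall x y, 0 <= U x y <= 1) -> (forall x y, U x y = U y x) ->
  (forall x y, 0 <= V x y) ->
  mean2 U <= C * p ^+ D ->
  mean2 (fun x y => V x y ^+ D) <= eta * p ^+ D ->
  mean (fun x => (x \in B)%:R) <= Dc * p ^+ D ->
  (forall x, mean (bulk U B x) <= gamma) ->
  dens H (fun x y => 1 + (U x y + V x y) / p) <=
  (indep_poly (star H) R).[hub_mass D p U B] +
  b%:R * (bulk_mass D p U B `^ 2^-1) ^+ #|H| +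
  ((#|{set H * H}| * #|{set H}|)%:R * slack H D p C Dc gamma +
   #|edges H|%:R * (eta `^ D%:R^-1 * perturb_const D C ^+ #|edges H|)).
Proof.
move=> D0 HD Hconn Hb p01 C1 Dc1 eta1 U01 Usym V0 hU hV hB hbulk.
have p0 : 0 < p by case/andP: p01.
have pn0 : p != 0 by rewrite gt_eqF.
have U0 x y : 0 <= U x y by case/andP: (U01 x y).
have two0 : 0 <= (2 ^+ D : R) by rewrite exprn_ge0.
have two1 : 1 <= (2 ^+ D : R) by rewrite exprn_ege1 // ler1n.
have hUp : mean2 (fun x y => (U x y / p) ^+ D) <= C.
  apply: (@le_trans _ _ (mean2 (fun x y => p ^- D * U x y))).
    apply: le_mean2 => x y; rewrite exprMn exprVn mulrC.
    rewrite ler_wpM2l ?invr_ge0 ?exprn_ge0 ?(ltW p0) //.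
    by case/andP: (U01 x y) => u0 u1; rewrite -[leRHS]expr1 ler_wiXn2l.
  by rewrite mean2Z mulrC ler_pdivrMr ?exprn_gt0.
have hVp : mean2 (fun x y => (V x y / p) ^+ D) <= eta.
  rewrite (_ : mean2 _ = p ^- D * mean2 (fun x y => V x y ^+ D)).
    by rewrite mulrC ler_pdivrMr ?exprn_gt0.
  rewrite -mean2Z; apply: eq_mean => x; apply: eq_mean => y.
  by rewrite exprMn exprVn mulrC.
rewrite horner_star_poly HD.
have -> : dens H (fun x y => 1 + (U x y + V x y) / p) =
    dens H (fun x y => (1 + U x y / p) + V x y / p).
  apply: eq_mean => phi; apply: eq_bigr => u _; by field.
apply: (le_trans (@dens_perturb R T H D T0 D0 HD (fun x y => 1 + U x y / p)
   (fun x y => V x y / p) (perturb_const D C) eta _ _ _ _ hVp)).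
- by move=> x y; rewrite addr_ge0 // divr_ge0 // ltW.
- by move=> x y; rewrite divr_ge0 // ltW.
- rewrite /perturb_const; apply: mulr_ege1 => //; rewrite lerDl mulr_ge0 //; lra.
- apply: (@le_trans _ _ (mean2 (fun x y =>
      2 ^+ D * (1 + 2 ^+ D * ((U x y / p) ^+ D + (V x y / p) ^+ D))))).
    apply: le_mean2 => x y; rewrite -addrA.
    have u0 : 0 <= U x y / p by rewrite divr_ge0 // ltW.
    have v0 : 0 <= V x y / p by rewrite divr_ge0 // ltW.
    apply: le_trans (exprD_le _ ler01 (addr_ge0 u0 v0)) _.
    rewrite expr1n ler_wpM2l // lerD2l; exact: exprD_le.
  rewrite mean2Z mean2D mean2_cst // mean2Z mean2D /perturb_const.
  rewrite ler_wpM2l // lerD2l ler_wpM2l // lerD //; exact: le_trans eta1.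
rewrite addrA lerD2r.
exact: (dens_le_masses T0 D0 HD Hconn p01 C1 Dc1 U01 Usym hU hB hbulk Hb).
Qed.

End DensityUpper.

(** * Estimates of the relative entropy *)

Section RelativeEntropy.
Variable R : realType.
Implicit Types p q x : R.

Lemma ln_ge1V x : 0 < x -> 1 - x^-1 <= ln x.
Proof.
move=> x0; have := expR_ge1Dx (- ln x).
by rewrite expRN lnK ?posrE // => h; lra.
Qed.

Lemma mul_ln_ge q p : 0 <= q -> 0 < p -> q - p <= q * ln (q / p).
Proof.
rewrite le_eqVlt => /orP[/eqP <-|q0] p0; first by rewrite mul0r sub0r oppr_le0 ltW.
apply: (@le_trans _ _ (q * (1 - (q / p)^-1))).
  rewrite invf_div mulrBr mulr1 mulrCA mulfV ?mulr1 // gt_eqF //.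
by rewrite ler_pM2l // ln_ge1V // divr_gt0.
Qed.

Lemma relent_ge0 p q : 0 < p < 1 -> 0 <= q <= 1 -> 0 <= relent p q.
Proof.
move=> /andP[p0 p1] /andP[q0 q1]; rewrite /relent.
have := mul_ln_ge q0 p0.
have : (1 - q) - (1 - p) <= (1 - q) * ln ((1 - q) / (1 - p)).
  by apply: mul_ln_ge; lra.
lra.
Qed.

Lemma relent_self p : 0 < p < 1 -> relent p p = 0.
Proof.
move=> /andP[p0 p1]; rewrite /relent !divff ?ln1 ?mulr0 ?addr0 //; lra.
Qed.

Lemma relent_one p : 0 < p -> relent p 1 = ln p^-1.
Proof. by move=> p0; rewrite /relent subrr mul0r addr0 !mul1r. Qed.

(** Since [q ln q + (1 - q) ln (1 - q)] is at least [-1], only [q ln (1 / p)]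
    remains up to a constant. *)
Lemma relent_ge_linear p q : 0 < p < 1 -> 0 < q <= 1 ->
  q * ln p^-1 - 1 <= relent p q.
Proof.
move=> /andP[p0 p1] /andP[q0 q1]; rewrite /relent.
have h1 : q - 1 <= q * ln (q / 1) by apply: mul_ln_ge; lra.
have h2 : (1 - q) - 1 <= (1 - q) * ln ((1 - q) / 1) by apply: mul_ln_ge; lra.
have h3 : (1 - q) * ln (1 - q) <= (1 - q) * ln ((1 - q) / (1 - p)).
  rewrite ler_wpM2l //; first lra.
  move: q1; rewrite le_eqVlt => /orP[/eqP ->|q1]; first by rewrite subrr mul0r.
  rewrite ler_ln ?posrE ?divr_gt0 //; try lra.
  by rewrite ler_peMr ?invf_ge1; lra.
rewrite !divr1 in h1 h2; rewrite lnM ?posrE ?invr_gt0 //; lra.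
Qed.

Lemma relent_ge_log p q : 0 < p < 1 -> 0 < q <= 1 ->
  q * ln (q / p) - (q - p) <= relent p q.
Proof.
move=> /andP[p0 p1] /andP[q0 q1]; rewrite /relent.
have : (1 - q) - (1 - p) <= (1 - q) * ln ((1 - q) / (1 - p)).
  by apply: mul_ln_ge; lra.
lra.
Qed.

(** The bound [relent_ge_log] with [ln_ge1V] applied to the square root of
    [q / p]; it is sharp enough, of order [x^2 / p], for [q = p + x] near [p]. *)
Lemma relent_ge_hellinger p q : 0 < p < 1 -> 0 < q <= 1 ->
  (Num.sqrt q - Num.sqrt p) ^+ 2 <= relent p q.
Proof.
move=> p01 q01; apply: le_trans (relent_ge_log p01 q01).
case/andP: p01 q01 => p0 p1 /andP[q0 q1].
set a := Num.sqrt q; set b := Num.sqrt p.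
have a0 : 0 < a by rewrite sqrtr_gt0.
have b0 : 0 < b by rewrite sqrtr_gt0.
have -> : q = a ^+ 2 by rewrite sqr_sqrtr // ltW.
have -> : p = b ^+ 2 by rewrite sqr_sqrtr // ltW.
have h := ln_ge1V (divr_gt0 a0 b0).
have -> : a ^+ 2 / b ^+ 2 = (a / b) ^+ 2 by rewrite expr_div_n.
rewrite lnXn ?divr_gt0 // -mulr_natl.
apply: (@le_trans _ _ (a ^+ 2 * (2 * (1 - (a / b)^-1)) - (a ^+ 2 - b ^+ 2))).
  rewrite le_eqVlt; apply/orP; left; apply/eqP; field.
  by rewrite !gt_eqF.
by rewrite lerB // ler_wpM2l ?sqr_ge0 // ler_wpM2l.
Qed.

(** For [x] above the square root of [p] the logarithm in [relent_ge_log] is at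
    least half of [ln (1 / p)], and [x >= x^2 / eps]. Below it, the bound
    [relent_ge_hellinger] is at least [x^2 / (6 sqrt p)], which is far more than
    needed. *)
Lemma relent_ge_square p x eps : 0 < p < 1 -> 0 < eps <= 1 -> 0 <= x <= eps -> p + x <= 1 ->
  4 <= ln p^-1 -> Num.sqrt p * ln p^-1 <= eps / 2 ->
  x ^+ 2 * ln p^-1 <= 4 * eps * relent p (p + x).
Proof.
move=> p01 /andP[e0 e1] /andP[x0 xe] px1 l4 lsmall.
have /andP[p0 p1] := p01.
have q01 : 0 < p + x <= 1 by lra.
set l := ln p^-1 in l4 lsmall *; set s := Num.sqrt p in lsmall *.
have s0 : 0 < s by rewrite sqrtr_gt0.
have sE : p = s ^+ 2 by rewrite sqr_sqrtr // ltW.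
have s1 : s <= 1 by rewrite -[leRHS]sqrtr1 ler_wsqrtr // ltW.
have ps : p <= s by rewrite sE expr2 ler_piMl // ltW.
have [sx|xs] := leP s x.
  have lnq : l / 2 <= ln ((p + x) / p).
    have -> : l = ln (s^-1) * 2.
      by rewrite /l sE -exprVn lnXn ?invr_gt0 // mulr_natr.
    rewrite mulfK // ler_ln ?posrE ?invr_gt0 ?divr_gt0 //; last lra.
    rewrite ler_pdivlMr // {1}sE expr2 mulKf ?gt_eqF //; lra.
  have h : x * l / 4 <= relent p (p + x).
    apply: le_trans (relent_ge_log p01 q01).
    have : (p + x) * (l / 2) <= (p + x) * ln ((p + x) / p) by rewrite ler_wpM2l //; lra.
    have : 0 <= x * (l - 4) by rewrite mulr_ge0 ?subr_ge0.
    have : 0 <= p * l by rewrite mulr_ge0 ?ltW //; lra.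
    lra.
  apply: (@le_trans _ _ (4 * eps * (x * l / 4))); last first.
    by rewrite ler_wpM2l // mulr_ge0 // ltW.
  have -> : 4 * eps * (x * l / 4) = eps * (x * l) by field.
  rewrite expr2 -mulrA ler_wpM2r // mulr_ge0 //; lra.
have h : x ^+ 2 / (6 * s) <= relent p (p + x).
  apply: le_trans (relent_ge_hellinger p01 q01).
  set a := Num.sqrt (p + x).
  have a0 : 0 < a by rewrite sqrtr_gt0; lra.
  have aE : a ^+ 2 = p + x by rewrite sqr_sqrtr //; lra.
  have xE : x = (a - s) * (a + s) by rewrite -subr_sqr aE sE; ring.
  rewrite -/s {1}xE exprMn ler_pdivrMr ?mulr_gt0 // ler_wpM2l ?sqr_ge0 //.
  have : 0 <= (a - s) ^+ 2 by apply: sqr_ge0.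
  have -> : (a + s) ^+ 2 = 2 * a ^+ 2 + 2 * s ^+ 2 - (a - s) ^+ 2 by ring.
  rewrite aE -sE; lra.
apply: (@le_trans _ _ (4 * eps * (x ^+ 2 / (6 * s)))); last first.
  by rewrite ler_wpM2l // mulr_ge0 // ltW.
have -> : 4 * eps * (x ^+ 2 / (6 * s)) = x ^+ 2 * (2 / 3 * eps / s).
  by field; rewrite gt_eqF.
rewrite ler_wpM2l ?sqr_ge0 // ler_pdivlMr // mulrC; lra.
Qed.

End RelativeEntropy.

(** Pigeonhole: the layers are disjoint, so their contributions add up to at most
    the mean of [d]. *)
Lemma light_layer (R : realType) (T : finType) (d : T -> R) (beta : nat -> R) (K : nat) :
  (0 < K)%N -> (forall x, 0 <= d x) -> (forall j, beta j.+1 <= beta j) ->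
  exists2 j, (j < K)%N &
    mean (fun x => d x * (beta j.+1 < d x <= beta j)%R%:R) <= mean d / K%:R.
Proof.
move=> K0 d0 beta_dec; apply/not_exists2P => no_layer.
pose m j := mean (fun x => d x * (beta j.+1 < d x <= beta j)%R%:R).
have gt j : (j < K)%N -> mean d / K%:R < m j.
  by move=> jK; have [|/negP] := no_layer j; [|rewrite -ltNge].
have : mean d < \sum_(j < K) m j.
  have -> : mean d = \sum_(j < K) mean d / K%:R.
    by rewrite sumr_const card_ord -[mean d / _ *+ _]mulr_natr mulfVK // pnatr_eq0 -lt0n.
  case: K K0 gt {no_layer} => // K _ gt.
  rewrite !big_ord_recl; apply: ltr_leD; first exact: gt.
  by apply: ler_sum => j _; apply/ltW/gt.
apply/negP; rewrite -leNgt /m -mean_sum; apply: le_mean => x.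
rewrite -mulr_sumr -[leRHS]mulr1 ler_wpM2l //.
have telescope j : (beta j.+1 < d x <= beta j)%R%:R =
    (beta j.+1 < d x)%R%:R - (beta j < d x)%R%:R :> R.
  case: (leP (d x) (beta j.+1)) => [le|lt]; case: (leP (d x) (beta j)) => [le'|lt'] /=;
    rewrite ?subrr ?subr0 //.
  by have := lt_le_trans lt' (le_trans le (beta_dec j)); rewrite ltxx.
under eq_bigr do rewrite telescope.
rewrite -(big_mkord xpredT (fun j => (beta j.+1 < d x)%R%:R - (beta j < d x)%R%:R)).
rewrite telescope_sumr //; case: (_ < _); case: (_ < _); rewrite /=; lra.
Qed.

Lemma small_p (R : realType) (L e : R) : 0 < e ->
  exists2 q, 0 < q & forall p, 0 < p < q ->
    [/\ p < 1, L <= ln p^-1 & Num.sqrt p * ln p^-1 <= e].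
Proof.
move=> e0; exists (Num.min 1 (Num.min (expR (- L)) ((e / 4) ^+ 4))).
  by rewrite !lt_min ltr01 expR_gt0 exprn_gt0 ?divr_gt0.
move=> p /andP[p0]; rewrite !lt_min => /and3P[p1 pL pe]; split=> //.
  rewrite -[L]expRK ler_ln ?posrE ?invr_gt0 ?expR_gt0 //.
  by rewrite -[expR L]invrK lef_pV2 ?posrE ?invr_gt0 ?expR_gt0 // -expRN ltW.
(* in terms of t = p^(1/4), the last product is - 4 t^2 ln t <= 4 t *)
set t := Num.sqrt (Num.sqrt p).
have t0 : 0 < t by rewrite !sqrtr_gt0.
have tp : t ^+ 2 = Num.sqrt p by rewrite sqr_sqrtr ?sqrtr_ge0.
have tE : t ^+ 4 = p by rewrite (exprM t 2 2) tp sqr_sqrtr ?ltW.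
have te : t <= e / 4.
  rewrite -(ler_pXn2r (_ : 0 < 4)%N) ?nnegrE ?(ltW t0) ?divr_ge0 ?(ltW e0) //.
  by rewrite tE ltW.
have := ln_ge1V t0; rewrite -tp -tE lnV ?posrE ?exprn_gt0 // lnXn // => h.
have : t ^+ 2 * - ln t <= t ^+ 2 * (t^-1 - 1) by rewrite ler_wpM2l ?sqr_ge0 //; lra.
have -> : t ^+ 2 * (t^-1 - 1) = t - t ^+ 2 by field; rewrite gt_eqF.
have : 0 <= t ^+ 2 by apply: sqr_ge0.
rewrite -mulr_natl; lra.
Qed.

(** * The lower bound *)

Section LowerCore.
Variable R : realType.

Lemma hom_densityE n (p : R) (H : sgraph) (X : 'M[R]_n) :
  hom_density p H X = dens H (fun i j => X i j / p).
Proof.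
rewrite /hom_density /dens /mean card_ffun card_ord natrX -mulrA; congr (_ * _).
rewrite mulr_sumr; apply: eq_bigr => phi _.
by rewrite big_split /= prodr_const mulrC exprVn.
Qed.

Lemma mean2_le_relent n (p kappa : R) (X : 'M[R]_n) (f : 'I_n -> 'I_n -> R) :
  (forall i j, i != j -> f i j <= kappa * relent p (X i j)) ->
  (forall i, f i i <= 0) ->
  mean2 f <= kappa * (n%:R ^- 2 * relent_mx p X).
Proof.
move=> fne feq; rewrite /mean2 /mean card_ord -mulr_sumr mulrA.
have -> : n%:R^-1 * n%:R^-1 = n%:R ^- 2 :> R by rewrite -invfM -expr2.
rewrite mulrCA ler_wpM2l ?invr_ge0 ?exprn_ge0 ?ler0n //.
rewrite /relent_mx mulr_sumr; apply: ler_sum => i _.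
rewrite mulr_sumr (bigD1 i) //= -[leRHS]add0r lerD ?feq //.
rewrite (eq_bigl (fun j => i != j)) => [|j]; last by rewrite eq_sym.
by apply: ler_sum => j /fne.
Qed.

Lemma mean2_sym (T : finType) (f : T -> T -> R) :
  mean2 f = mean2 (fun x y => f y x).
Proof. by rewrite /mean2 mean_exchange. Qed.

(** The lower bound for a single matrix, with all error terms kept explicit.
    [beta] is the sequence of thresholds between which a light layer is chosen,
    [eta] bounds the part of the excess that is thrown away, [tau1] the error in
    the density, [tau2] the mass shared by two hubs, and [rho] the relative loss
    in [relent_ge_linear]. *)
Lemma lower_core (k s D n K : nat) (H : 'I_k -> sgraph) (delta : 'I_k -> R)
    (c c0 C eps rho eta tau1 tau2 p : R) (beta : nat -> R) (X : 'M[R]_n) :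
  (forall i, connected_graph (H i)) -> (2 <= D)%N -> (forall i, maxdeg (H i) = D) ->
  (forall i : 'I_k, regular (H i) D <-> (i < s)%N) ->
  lbound (objective_values s H delta) c ->
  (0 < n)%N -> 0 < p < 1 -> 0 < eps <= 1 -> 0 < rho <= 1 -> 4 <= ln p^-1 ->
  Num.sqrt p * ln p^-1 <= eps / 2 -> 2 <= rho * eps * ln p^-1 ->
  admissible p H (fun i => 1 + delta i) X ->
  0 <= c0 -> relent_mx p X <= 2 * c0 * anp D n p ->
  1 <= C -> 4 * c0 <= C -> (0 < K)%N ->
  (forall j, beta j.+1 <= beta j) -> (forall j, 0 < beta j) -> beta 0%N <= 1 ->
  eta <= 1 -> 8 * c0 * eps + 2 * C / K%:R <= eta ->
  0 <= tau1 ->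
  (forall i j, (j < K)%N ->
    (#|{set H i * H i}| * #|{set H i}|)%:R * slack (H i) D p C (C / beta j) (beta j.+1) +
    #|edges (H i)|%:R * (eta `^ D%:R^-1 * perturb_const D C ^+ #|edges (H i)|) <= tau1) ->
  (forall j, (j < K)%N -> (C / beta j) ^+ 2 * p ^+ D <= tau2) ->
  c <= tau1 + tau2 / 2 + (1 + rho) * (relent_mx p X / (2 * anp D n p)).
Proof.
move=> Hconn D2 HD Hreg hc n0 p01 eps01 rho01 l4 lsmall lbig [Xw Xhom] c00 Xcost C1 c0C K0
  beta_dec beta0 beta_le1 eta1 hetas tau10 herr htau2.
have [XT X01 Xdiag] := Xw.
have /andP[p0 p1] := p01; have /andP[e0 e1] := eps01; have /andP[r0 r1] := rho01.
have Xsym i j : X i j = X j i by rewrite -{1}XT mxE.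
have T0 : (0 < #|'I_n|)%N by rewrite card_ord.
have D0 : (0 < D)%N by apply: ltn_trans D2.
set l := ln p^-1 in l4 lsmall lbig *; have l0 : 0 < l by lra.
have pD0 : 0 < p ^+ D by rewrite exprn_gt0.
pose r := n%:R ^- 2 * relent_mx p X.
have nn0 : 0 < n%:R ^+ 2 :> R by rewrite exprn_gt0 // ltr0n.
have relE : relent_mx p X = n%:R ^+ 2 * r by rewrite /r mulrA mulfV ?mul1r // gt_eqF.
have r_le : r <= 2 * c0 * p ^+ D * l.
  have : n%:R ^+ 2 * r <= n%:R ^+ 2 * (2 * c0 * p ^+ D * l).
    by rewrite -relE (le_trans Xcost) // /anp -/l le_eqVlt; apply/orP; left; apply/eqP; ring.
  by rewrite ler_pM2l.
pose U i j := Num.max (X i j - p) 0.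
have U0 i j : 0 <= U i j by rewrite /U le_max lexx orbT.
have U1 i j : U i j <= 1 - p.
  have /andP[_ x1] := X01 i j; rewrite /U ge_max; apply/andP; split; lra.
have Usym i j : U i j = U j i by rewrite /U Xsym.
have Udiag i : U i i = 0 by rewrite /U Xdiag max_r //; lra.
have XU i j : X i j <= p + U i j.
  by rewrite /U -lerBlDl le_max lexx.
(* entries at most p contribute nothing to U, and their entropy is nonnegative *)
have relU i j : i != j -> U i j = 0 \/ (0 < U i j /\ X i j = p + U i j).
  move=> _; rewrite /U; case: (leP (X i j - p) 0) => h; [by left|right].
  by split=> //; ring.
have rel0 i j : 0 <= relent p (X i j) by apply: relent_ge0.
(* the large part of the excess: its cost is essentially its mass *)
pose Ub i j := if eps <= U i j then U i j else 0.
have Ub0 i j : 0 <= Ub i j by rewrite /Ub; case: ifP.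
have UbU i j : Ub i j <= U i j by rewrite /Ub; case: ifP.
have Ubsym i j : Ub i j = Ub j i by rewrite /Ub Usym.
have Ub_mean_l : mean2 Ub * l <= (1 + rho) * r.
  rewrite mulrC -mean2Z; apply: mean2_le_relent => [i j ij|i]; last first.
    by rewrite /Ub Udiag; case: ifP; rewrite mulr0.
  have nn : 0 <= (1 + rho) * relent p (X i j) by rewrite mulr_ge0 //; lra.
  rewrite /Ub; case: ifP => [eU|_]; last by rewrite mulr0.
  have [->|[Upos XE]] := relU _ _ ij; first by rewrite mulr0.
  have q01 : 0 < X i j <= 1 by have /andP[_ x1] := X01 i j; rewrite x1 andbT XE; lra.
  have h1 := relent_ge_linear p01 q01; rewrite -/l in h1.
  have h2 : U i j * l <= X i j * l by rewrite ler_wpM2r ?(ltW l0) // XE; lra.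
  have h3 : rho * eps * l <= rho * U i j * l.
    by rewrite ler_wpM2r ?(ltW l0) // ler_wpM2l // ltW.
  have h4 : (1 + rho) * (U i j * l - 1) <= (1 + rho) * relent p (X i j).
    by rewrite ler_wpM2l //; lra.
  apply: le_trans h4; lra.
have r0' : 0 <= r.
  by rewrite mulr_ge0 ?invr_ge0 ?(ltW nn0) // /relent_mx sumr_ge0 // => i _; rewrite sumr_ge0.
have Ub_mean : mean2 Ub <= C * p ^+ D.
  have h : mean2 Ub * l <= (C * p ^+ D) * l.
    apply: le_trans Ub_mean_l _; apply: (@le_trans _ _ (2 * (2 * c0 * p ^+ D * l))).
      by apply: ler_pM => //; lra.
    have -> : 2 * (2 * c0 * p ^+ D * l) = (4 * c0) * (p ^+ D * l) by ring.
    by rewrite -[leRHS]mulrA ler_wpM2r // mulr_ge0 // ltW.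
  by move: h; rewrite ler_pM2r.
(* the small part is negligible in mean square *)
have Us_mean : mean2 (fun i j => (U i j - Ub i j) ^+ 2) <= 8 * c0 * eps * p ^+ D.
  have h : mean2 (fun i j => l * (U i j - Ub i j) ^+ 2) <= 4 * eps * r.
    apply: mean2_le_relent => [i j ij|i]; last first.
      by rewrite /Ub Udiag; case: ifP => _; rewrite subrr expr0n mulr0.
    have nn : 0 <= 4 * eps * relent p (X i j) by rewrite mulr_ge0 // mulr_ge0 // ltW.
    rewrite /Ub; case: (leP eps (U i j)) => [_|Ue]; first by rewrite subrr expr0n mulr0.
    rewrite subr0 mulrC.
    have [->|[Upos XE]] := relU _ _ ij; first by rewrite expr0n mul0r.
    rewrite XE; apply: relent_ge_square => //; first by rewrite U0 ltW.
    by rewrite -XE; case/andP: (X01 i j).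
  have {}h : l * mean2 (fun i j => (U i j - Ub i j) ^+ 2) <= l * (8 * c0 * eps * p ^+ D).
    rewrite -mean2Z (le_trans h) //.
    have -> : l * (8 * c0 * eps * p ^+ D) = 4 * eps * (2 * c0 * p ^+ D * l) by ring.
    by rewrite ler_wpM2l // mulr_ge0 // ltW.
  by move: h; rewrite ler_pM2l.
(* hubs are the rows above the light layer; rows in the layer are discarded *)
pose d i := mean (Ub i).
have d0 i : 0 <= d i by apply: mean_ge0.
have [j jK layer] := light_layer K0 d0 beta_dec.
pose M i := (beta j.+1 < d i <= beta j)%R.
pose B : {set 'I_n} := [set i | beta j < d i].
have dmean : mean d <= C * p ^+ D by [].
have Bmean : mean (fun i => (i \in B)%:R) <= C / beta j * p ^+ D.
  rewrite mulrAC ler_pdivlMr // mulrC -meanZ; apply: le_trans dmean; apply: le_mean => i.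
  by rewrite inE; case: ltP => [lt|_]; rewrite ?mulr1 ?mulr0 // ltW.
pose U' i j' := if M i || M j' then 0 else Ub i j'.
have U'0 i j' : 0 <= U' i j' by rewrite /U'; case: ifP.
have U'Ub i j' : U' i j' <= Ub i j' by rewrite /U'; case: ifP.
have U'01 i j' : 0 <= U' i j' <= 1.
  rewrite U'0 (le_trans (U'Ub _ _)) // (le_trans (UbU _ _)) // (le_trans (U1 _ _)) //; lra.
have U'sym i j' : U' i j' = U' j' i by rewrite /U' orbC Ubsym.
pose V i j' := U i j' - U' i j'.
have V0 i j' : 0 <= V i j' by rewrite subr_ge0 (le_trans (U'Ub _ _)).
have layer_mean : mean2 (fun i j' => Ub i j' * (M i)%:R) <= C * p ^+ D / K%:R.
  apply: (@le_trans _ _ (mean d / K%:R)); last by rewrite ler_wpM2r // invr_ge0 ler0n.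
  apply: le_trans layer; apply: le_mean => i; rewrite mulrC -meanZ.
  by apply: le_mean => j'; rewrite mulrC.
have Vmean : mean2 (fun i j' => V i j' ^+ D) <= eta * p ^+ D.
  apply: (@le_trans _ _ (mean2 (fun i j' => (U i j' - Ub i j') ^+ 2 +
      (Ub i j' * (M i)%:R + Ub i j' * (M j')%:R)))).
    apply: le_mean2 => i j'.
    have V1 : V i j' <= 1 by have := U1 i j'; have := U'0 i j'; rewrite /V; lra.
    apply: (@le_trans _ _ (V i j' ^+ 2)); first exact: ler_wiXn2l.
    have VX : V i j' ^+ 2 <= V i j' by rewrite -[leRHS]expr1 ler_wiXn2l.
    have VU : V i j' <= U i j' by rewrite /V lerBlDr lerDl.
    have V2U2 : V i j' ^+ 2 <= U i j' ^+ 2 by apply: lerXn2r => //; rewrite nnegrE.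
    have VXU := le_trans VX VU.
    have VE : U' i j' = U i j' -> V i j' ^+ 2 <= 0 by rewrite /V => ->; rewrite subrr expr0n.
    move: (U0 i j') VE; rewrite /U' /Ub; case: (leP eps (U i j')) => _.
      rewrite subrr expr0n /= add0r.
      case: (M i); case: (M j') => Uij VE; rewrite /= ?mulr1 ?mulr0 ?addr0 ?add0r //.
        by apply: le_trans VXU _; rewrite lerDl.
      exact: VE.
    by move=> *; rewrite !mul0r !addr0 subr0.
  rewrite mean2D mean2D.
  have -> : mean2 (fun i j' => Ub i j' * (M j')%:R) = mean2 (fun i j' => Ub i j' * (M i)%:R).
    by rewrite mean2_sym; apply: eq_mean => i; apply: eq_mean => j'; rewrite Ubsym.
  apply: (@le_trans _ _ ((8 * c0 * eps + 2 * C / K%:R) * p ^+ D)); last first.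
    by rewrite ler_wpM2r // ltW.
  have -> : (8 * c0 * eps + 2 * C / K%:R) * p ^+ D =
    8 * c0 * eps * p ^+ D + (C * p ^+ D / K%:R + C * p ^+ D / K%:R).
    by field; rewrite pnatr_eq0 -lt0n.
  by rewrite !lerD.
have bulk_row i : mean (bulk U' B i) <= beta j.+1.
  have b0 : 0 <= beta j.+1 by apply: ltW.
  have le_Ub : mean (bulk U' B i) <= d i.
    by apply: le_mean => j'; apply: le_trans (U'Ub i j'); apply: bulk_le.
  case: (leP (d i) (beta j.+1)) => [h|lt]; first exact: le_trans h.
  rewrite (eq_mean (g := fun=> 0)) ?mean_cst // => j'.
  rewrite /bulk /U' inE /M lt /=; case: (leP (d i) (beta j)) => //= _.
  by case: ifP.
pose theta := hub_mass D p U' B; pose zeta := bulk_mass D p U' B.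
have theta0 : 0 <= theta by apply: hub_mass_ge0.
have zeta0 : 0 <= zeta by apply: bulk_mass_ge0.
have Dc1 : 1 <= C / beta j.
  rewrite ler_pdivlMr // mul1r (le_trans _ C1) // (le_trans _ beta_le1) //.
  by elim: (j) => // m IH; apply: le_trans (beta_dec m) IH.
have U'mean : mean2 U' <= C * p ^+ D by apply: le_trans Ub_mean; apply: le_mean2.
have feas : feasible s H delta (theta + tau1) (zeta `^ 2^-1).
  split; [exact: addr_ge0|exact: powR_ge0|] => i.
  apply: le_trans (Xhom i) _; rewrite hom_densityE.
  have Hi0 : (0 < #|H i|)%N by case: (Hconn i).
  apply: (@le_trans _ _ (dens (H i) (fun x y => 1 + (U' x y + V x y) / p))).
    apply: le_mean => phi; apply: ler_prod => u _.
    have /andP[x0 _] := X01 (phi u.1) (phi u.2).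
    rewrite divr_ge0 ?(ltW p0) //= ler_pdivrMr // mulrDl mul1r mulfVK ?gt_eqF //.
    by rewrite /V [U' _ _ + _]addrC subrK; apply: XU.
  have := dens_upper T0 D0 (HD i) (Hconn i) (Hreg i) p01 C1 Dc1 eta1 U'01 U'sym V0
    U'mean Vmean Bmean bulk_row.
  move=> /le_trans; apply; rewrite -/theta -/zeta.
  apply: (@le_trans _ _ ((indep_poly (star (H i)) R).[theta] +
    (i < s)%N%:R * zeta `^ 2^-1 ^+ #|H i| + tau1)).
    by rewrite lerD2l; apply: herr.
  rewrite addrAC lerD //; first exact: star_poly_growth.
  case: (boolP (i < s)%N) => [si|_]; last by rewrite !mul0r.
  rewrite le_eqVlt; apply/orP; left; apply/eqP; congr (_ * _ ^+ _).
  rewrite card_sig; apply: eq_card => x; rewrite !inE.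
  by have /Hreg -> := si; rewrite HD eqxx.
have c_le := hc _ (ex_intro _ _ (ex_intro _ _ (conj feas erefl))).
apply: le_trans c_le _.
have -> : (zeta `^ 2^-1) ^+ 2 = zeta.
  by rewrite -powR_mulrn ?powR_ge0 // -powRrM mulVf ?powRr1 // pnatr_eq0.
(* an entry is counted twice in 2 * theta + zeta only if it joins two hubs *)
have mass : 2 * theta + zeta <= p ^- D * mean2 U' + tau2.
  apply: (@le_trans _ _ (p ^- D * (mean2 U' +
      mean (fun i => (i \in B)%:R) * mean (fun i => (i \in B)%:R)))); last first.
    rewrite mulrDr lerD2l; apply: le_trans (htau2 j jK).
    apply: (@le_trans _ _ (p ^- D * ((C / beta j * p ^+ D) * (C / beta j * p ^+ D)))).
      rewrite ler_wpM2l ?invr_ge0 ?(ltW pD0) //.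
      by apply: ler_pM => //; apply: mean_ge0 => i; rewrite ler0n.
    rewrite le_eqVlt; apply/orP; left; apply/eqP; field.
    by rewrite !gt_eqF.
  have -> : 2 * theta + zeta = p ^- D * (mean2 (fun x y => U' x y * (x \in B)%:R) +
      mean2 (fun x y => U' x y * (y \in B)%:R) + mean2 (bulk U' B)).
    rewrite [X in _ + X + _]mean2_sym.
    rewrite (_ : mean2 (fun x y => U' y x * (x \in B)%:R) =
                 mean2 (fun x y => U' x y * (x \in B)%:R)); last first.
      by apply: eq_mean => x; apply: eq_mean => y; rewrite U'sym.
    by rewrite /theta /zeta /hub_mass /bulk_mass; ring.
  rewrite ler_wpM2l ?invr_ge0 ?(ltW pD0) //.
  have -> : mean (fun i => (i \in B)%:R) * mean (fun i => (i \in B)%:R) =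
      mean2 (fun x y : 'I_n => (x \in B)%:R * (y \in B)%:R) :> R.
    by rewrite /mean2 mulrC -meanZ; apply: eq_mean => x; rewrite mulrC meanZ.
  rewrite -!mean2D; apply: le_mean2 => x y; rewrite /bulk.
  have /andP[u0 u1] := U'01 x y.
  by case: (x \in B); case: (y \in B) => /=; rewrite ?mulr1 ?mulr0 ?addr0 ?add0r //; lra.
have U'r : p ^- D * mean2 U' <= (1 + rho) * (2 * (relent_mx p X / (2 * anp D n p))).
  have -> : 2 * (relent_mx p X / (2 * anp D n p)) = p ^- D * (r / l).
    rewrite relE /anp -/l; field.
    by rewrite !gt_eqF // ltr0n.
  rewrite [leRHS]mulrCA ler_wpM2l ?invr_ge0 ?(ltW pD0) // mulrA ler_pdivlMr //.
  by apply: le_trans Ub_mean_l; rewrite ler_wpM2r ?(ltW l0) // le_mean2.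
lra.
Qed.

End LowerCore.

Section LowerBound.
Variable R : realType.

(** Choice of the parameters of [lower_core]: first the fraction [eta] to be
    thrown away, then [eps] and the number of layers, then the thresholds, each
    in terms of the previous one, and last the bound on [p]. *)
Lemma lower_bound (k s D : nat) (H : 'I_k -> sgraph) (delta : 'I_k -> R) (c tau : R) :
  (forall i, connected_graph (H i)) -> (2 <= D)%N -> (forall i, maxdeg (H i) = D) ->
  (forall i : 'I_k, regular (H i) D <-> (i < s)%N) ->
  lbound (objective_values s H delta) c -> 0 <= c -> 0 < tau ->
  exists2 q, 0 < q & forall n p (X : 'M[R]_n), (0 < n)%N -> 0 < p < q ->
    admissible p H (fun i => 1 + delta i) X ->
    c - tau <= relent_mx p X / (2 * anp D n p).
Proof.
move=> Hconn D2 HD Hreg hc c0 tau0.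
have D0 : (0 < D)%N by apply: ltn_trans D2.
pose C := 4 * c + 1; have C1 : 1 <= C by rewrite /C; lra.
have C0 : 0 <= C by lra.
pose tau1 := tau / 4; have tau10 : 0 < tau1 by rewrite /tau1; lra.
pose rho := Num.min 1 (tau / (4 * c + 4)).
have rho0 : 0 < rho by rewrite lt_min ltr01 divr_gt0 //; lra.
have rho1 : rho <= 1 by rewrite ge_min lexx.
have rhoc : rho * c <= tau / 4.
  have h : rho <= tau / (4 * c + 4) by rewrite ge_min lexx orbT.
  have : rho * (4 * c + 4) <= tau by rewrite -ler_pdivlMr //; lra.
  lra.
pose A := 1 + \sum_i #|edges (H i)|%:R * perturb_const D C ^+ #|edges (H i)|.
have Pc0 : 0 <= perturb_const D C.
  by rewrite /perturb_const !(mulr_ge0, addr_ge0) ?exprn_ge0.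
have A0 : 0 < A.
  by rewrite ltr_wpDr // sumr_ge0 // => i _; rewrite mulr_ge0 ?exprn_ge0.
pose eta := Num.min 1 ((tau1 / (2 * A)) ^+ D).
have eta0 : 0 < eta.
  by rewrite lt_min ltr01 exprn_gt0 // divr_gt0 // mulr_gt0.
have eta1 : eta <= 1 by rewrite ge_min lexx.
have eta_root : eta `^ D%:R^-1 <= tau1 / (2 * A).
  have h0 : 0 <= tau1 / (2 * A) by rewrite divr_ge0 ?mulr_ge0 // ltW.
  rewrite -[leRHS](powR_root D0) //; apply: ge0_ler_powR.
  - by rewrite invr_ge0 ler0n.
  - by rewrite nnegrE ltW.
  - by rewrite nnegrE exprn_ge0.
  - by rewrite ge_min lexx orbT.
pose eps := eta / (16 * c + 16).
have eps0 : 0 < eps by rewrite divr_gt0 //; lra.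
have eps1 : eps <= 1 by rewrite ler_pdivrMr; lra.
have c_eps : 8 * c * eps <= eta / 2.
  have : eps * (16 * c + 16) = eta by rewrite mulfVK // gt_eqF //; lra.
  lra.
pose K := (Num.truncn (4 * C / eta)).+1.
have KE : 2 * C / K%:R <= eta / 2.
  have h : 4 * C / eta < K%:R by apply: truncnS_gt.
  rewrite ler_pdivrMr ?ltr0n //.
  have : 4 * C < K%:R * eta by rewrite -ltr_pdivrMr.
  lra.
pose f (b : R) : R := 1 + \sum_i (#|{set H i * H i}| * #|{set H i}|)%:R *
  ((C / b) ^+ #|H i| * C ^+ #|edges (H i)|).
have f_ge1 b : 0 < b -> 1 <= f b.
  move=> b0; rewrite lerDl sumr_ge0 // => i _.
  by rewrite !mulr_ge0 ?exprn_ge0 // divr_ge0 // ltW.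
(* the next threshold absorbs the factor f b that comes from the number of hubs *)
pose step (b : R) := Num.min b ((tau1 / (4 * f b)) ^+ D).
pose beta j : R := iter j step 1.
have beta0 j : 0 < beta j.
  elim: j => [|j IH] /=; first exact: ltr01.
  rewrite lt_min IH exprn_gt0 // divr_gt0 // mulr_gt0 //.
  exact: lt_le_trans (f_ge1 _ IH).
have beta_dec j : beta j.+1 <= beta j by rewrite /beta /= ge_min lexx.
have beta_root j : beta j.+1 `^ D%:R^-1 <= tau1 / (4 * f (beta j)).
  have f0 : 0 < f (beta j) by apply: lt_le_trans (f_ge1 _ (beta0 j)).
  have h0 : 0 <= tau1 / (4 * f (beta j)) by rewrite divr_ge0 ?mulr_ge0 // ltW.
  rewrite -[leRHS](powR_root D0) //; apply: ge0_ler_powR.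
  - by rewrite invr_ge0 ler0n.
  - by rewrite nnegrE ltW.
  - by rewrite nnegrE exprn_ge0.
  - by rewrite /beta /= ge_min lexx orbT.
pose M := 1 + \sum_(j < K) (f (beta j) * (4 / tau1) + (C / beta j) ^+ 2 / tau1).
have term0 j : 0 <= f (beta j) * (4 / tau1) /\ 0 <= (C / beta j) ^+ 2 / tau1.
  have f0 : 0 <= f (beta j) by apply: le_trans (f_ge1 _ (beta0 j)).
  by split; rewrite !(mulr_ge0, invr_ge0) // ?sqr_ge0 // ltW.
have M0 : 0 < M.
  by rewrite ltr_wpDr // sumr_ge0 // => j _; have [? ?] := term0 j; rewrite addr_ge0.
have leM j : (j < K)%N -> f (beta j) * (4 / tau1) + (C / beta j) ^+ 2 / tau1 <= M.
  move=> jK; rewrite /M (bigD1 (Ordinal jK)) //= addrCA lerDl addr_ge0 // sumr_ge0 // => i _.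
  by have [? ?] := term0 i; rewrite addr_ge0.
have eps20 : 0 < eps / 2 by rewrite divr_gt0.
have [q0 q00 hq] := @small_p R (Num.max 4 (2 / (rho * eps))) (eps / 2) eps20.
exists (Num.min q0 M^-1); first by rewrite lt_min q00 invr_gt0.
move=> n p X n0 /andP[p0]; rewrite lt_min => /andP[pq pM] Xadm.
have [|p1 + lsmall] := hq p; first by rewrite p0.
rewrite ge_max => /andP[l4 lbig].
have a0 : 0 < anp D n p.
  by rewrite /anp !mulr_gt0 ?exprn_gt0 ?ltr0n //; apply: lt_le_trans l4.
(* a matrix of cost at least c satisfies the claim *)
have [cle|clt] := leP c (relent_mx p X / (2 * anp D n p)); first by lra.
have pM1 : p * M <= 1 by rewrite -ler_pdivlMr // mul1r ltW.
have p01 : 0 < p < 1 by rewrite p0.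
suff h : c <= tau1 + tau1 / 2 + (1 + rho) * (relent_mx p X / (2 * anp D n p)).
  have : rho * (relent_mx p X / (2 * anp D n p)) <= rho * c by rewrite ler_pM2l // ltW.
  by move: h; rewrite /tau1; lra.
apply: (@lower_core R k s D n K H delta c c C eps rho eta tau1 tau1 p beta X) => //.
- by rewrite eps0.
- by rewrite rho0.
- by move: lbig; rewrite ler_pdivrMr ?(mulr_gt0 rho0 eps0) // mulrC.
- by move: clt; rewrite ltr_pdivrMr ?(mulr_gt0 _ a0) // => /ltW; rewrite mulrA [c * 2]mulrC.
- by rewrite /C; lra.
- have eta2 : eta = eta / 2 + eta / 2 by field.
  rewrite [leRHS]eta2.
  exact: lerD.
- exact: ltW.
- move=> i j jK.
  have fj := f_ge1 _ (beta0 j).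
  have -> : tau1 = tau1 / 2 + tau1 / 2 by field.
  apply: lerD.
    have g0 : 0 <= p + beta j.+1 `^ D%:R^-1 by rewrite addr_ge0 ?powR_ge0 // ltW.
    have pf : p * f (beta j) <= tau1 / 4.
      have h : p * (f (beta j) * (4 / tau1)) <= 1.
        apply: le_trans pM1; rewrite ler_pM2l //; apply: le_trans (leM j jK).
        by rewrite lerDl; have [] := term0 j.
      have -> : p * f (beta j) = (p * (f (beta j) * (4 / tau1))) * (tau1 / 4).
        by field; rewrite gt_eqF.
      by rewrite -[leRHS]mul1r ler_wpM2r //; lra.
    have gf : beta j.+1 `^ D%:R^-1 * f (beta j) <= tau1 / 4.
      apply: (@le_trans _ _ (tau1 / (4 * f (beta j)) * f (beta j))).
        by rewrite ler_wpM2r //; lra.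
      rewrite le_eqVlt; apply/orP; left; apply/eqP; field; rewrite gt_eqF //; lra.
    rewrite /slack mulrA; apply: (@le_trans _ _ (f (beta j) * (p + beta j.+1 `^ D%:R^-1))).
      rewrite ler_wpM2r // /f (bigD1 i) //= addrCA lerDl addr_ge0 // sumr_ge0 // => i' _.
      by rewrite !mulr_ge0 ?exprn_ge0 // divr_ge0 // ltW.
    lra.
  rewrite mulrCA; apply: (@le_trans _ _ (tau1 / (2 * A) * A)); last first.
    by rewrite le_eqVlt; apply/orP; left; apply/eqP; field; rewrite gt_eqF.
  apply: ler_pM; rewrite ?powR_ge0 ?mulr_ge0 ?exprn_ge0 //.
  rewrite /A (bigD1 i) //= addrCA lerDl addr_ge0 // sumr_ge0 // => i' _.
  by rewrite mulr_ge0 ?exprn_ge0.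
- move=> j jK.
  have h : p * ((C / beta j) ^+ 2 / tau1) <= 1.
    apply: le_trans pM1; rewrite ler_pM2l //; apply: le_trans (leM j jK).
    by rewrite lerDr; have [] := term0 j.
  have pD : p ^+ D <= p by rewrite -[leRHS]expr1 ler_wiXn2l // ltW.
  apply: (@le_trans _ _ ((C / beta j) ^+ 2 * p)); first by rewrite ler_wpM2l ?sqr_ge0.
  have -> : (C / beta j) ^+ 2 * p = (p * ((C / beta j) ^+ 2 / tau1)) * tau1.
    by field; rewrite !gt_eqF.
  by rewrite -[leRHS]mul1r ler_wpM2r // ltW.
Qed.

End LowerBound.

(** * Planted hubs and cliques *)

Section Planted.
Variables (R : realType) (n a b D : nat) (p : R).
Hypothesis n0 : (0 < n)%N.
Hypothesis ab_le : (a + b <= n)%N.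
Hypothesis D0 : (0 < D)%N.
Hypothesis p01 : 0 < p < 1.

Definition hub (i : 'I_n) := (i < a)%N.
Definition clique (i : 'I_n) := (a <= i < a + b)%N.
Definition rest (i : 'I_n) := (a + b <= i)%N.
Definition full_entry (i j : 'I_n) := [|| hub i, hub j | clique i && clique j].
Definition full_weight (i j : 'I_n) : R := if full_entry i j then 1 else p.
Definition planted : 'M[R]_n := \matrix_(i, j) if i == j then 0 else full_weight i j.

Let T0 : (0 < #|'I_n|)%N. Proof. by rewrite card_ord. Qed.
Let p0 : 0 < p. Proof. by case/andP: p01. Qed.
Let p1 : p < 1. Proof. by case/andP: p01. Qed.

Lemma full_weight_ge i j : p <= full_weight i j.
Proof. by rewrite /full_weight; case: ifP => // _; apply: ltW. Qed.

Lemma full_weight_le1 i j : full_weight i j <= 1.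
Proof. by rewrite /full_weight; case: ifP => // _; apply: ltW. Qed.

Lemma wgraph_planted : wgraph planted.
Proof.
split=> [|i j|i]; last by rewrite mxE eqxx.
  apply/matrixP => i j; rewrite !mxE eq_sym; case: ifP => // _.
  by rewrite /full_weight /full_entry orbCA [clique j && _]andbC.
rewrite mxE; case: ifP => _; first by rewrite lexx ler01.
by rewrite full_weight_le1 (le_trans (ltW p0)) ?full_weight_ge.
Qed.

Lemma mean_lt m : (m <= n)%N -> mean (fun i : 'I_n => (i < m)%N%:R) = m%:R / n%:R :> R.
Proof.
move=> mn; rewrite /mean card_ord mulrC; congr (_ / _).
rewrite -(big_mkord xpredT (fun i => (i < m)%N%:R)) (big_cat_nat (leq0n m) mn) /=.
rewrite (@eq_big_nat _ _ _ 0%N m _ (fun=> 1)); last by move=> i /andP[_ ->].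
rewrite [X in _ + X]big_nat [X in _ + X]big1 => [|i /andP[mi _]]; last first.
  by rewrite ltnNge mi.
by rewrite addr0 sumr_const_nat subn0.
Qed.

Lemma mean_hub : mean (fun i => (hub i)%:R) = a%:R / n%:R :> R.
Proof. by apply: mean_lt; apply: leq_trans ab_le; rewrite leq_addr. Qed.

Lemma hub_clique_rest i : (hub i)%:R + (clique i)%:R + (rest i)%:R = 1 :> R.
Proof.
rewrite /hub /clique /rest; case: (ltnP i a) => ia /=.
  by rewrite leqNgt (leq_trans ia) ?leq_addr //= !addr0.
by case: (ltnP i (a + b)); rewrite ?addr0 ?add0r.
Qed.

Lemma mean_clique : mean (fun i => (clique i)%:R) = b%:R / n%:R :> R.
Proof.
have -> : b%:R / n%:R = (a + b)%:R / n%:R - a%:R / n%:R :> R by rewrite natrD; ring.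
rewrite -mean_hub -(mean_lt ab_le) -[X in _ - X]mul1r -mulNr -meanZ -meanD.
apply: eq_mean => i; have := hub_clique_rest i; rewrite /hub /clique /rest.
by rewrite mulN1r; case: (leqP (a + b) i) => ?; case: (ltnP i a) => ? /= ?; lra.
Qed.

Lemma mean_rest : mean (fun i => (rest i)%:R) = 1 - a%:R / n%:R - b%:R / n%:R :> R.
Proof.
rewrite (eq_mean (g := fun i => 1 + (-1 * (hub i)%:R + -1 * (clique i)%:R))).
  by rewrite meanD mean_cst // meanD !meanZ mean_hub mean_clique; ring.
by move=> i; have := hub_clique_rest i; lra.
Qed.

Definition full_fraction : R := 2 * (a%:R / n%:R) + (b%:R / n%:R) ^+ 2.

Lemma mean2_full_entry : mean2 (fun i j => (full_entry i j)%:R) <= full_fraction.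
Proof.
have -> : full_fraction = mean2 (fun i j : 'I_n =>
    (hub i)%:R + (hub j)%:R + (clique i)%:R * (clique j)%:R).
  rewrite !mean2D /full_fraction -mean_hub -mean_clique mulrDl !mul1r.
  congr (_ + _ + _); rewrite /mean2.
  - by apply: eq_mean => i; rewrite mean_cst.
  - by rewrite mean_cst.
  - rewrite expr2 -meanZ; apply: eq_mean => i.
    by rewrite mulrC meanZ.
apply: le_mean2 => i j; rewrite /full_entry.
by case: (hub i); case: (hub j); case: (clique i); case: (clique j) => /=; lra.
Qed.

Lemma relent_planted :
  relent_mx p planted <= n%:R ^+ 2 * ln p^-1 * full_fraction.
Proof.
have l0 : 0 <= ln p^-1 by rewrite ln_ge0 // invf_ge1 // ltW.
rewrite -mulrA; apply: (@le_trans _ _ (n%:R ^+ 2 * mean2 (fun i j => ln p^-1 * (full_entry i j)%:R))).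
  rewrite /mean2 /mean card_ord -mulr_sumr mulrA.
  have -> : n%:R ^+ 2 * n%:R^-1 = n%:R :> R by rewrite expr2 mulfK // pnatr_eq0 -lt0n.
  rewrite mulrA mulfV ?mul1r ?pnatr_eq0 -?lt0n // /relent_mx; apply: ler_sum => i _.
  rewrite big_mkcond; apply: ler_sum => j _; rewrite mxE.
  case: eqVneq => /= _; first by rewrite mulr_ge0.
  rewrite /full_weight; case: ifP => _; first by rewrite relent_one // mulr1.
  by rewrite relent_self // mulr0.
by rewrite mean2Z !ler_wpM2l ?sqr_ge0 // mean2_full_entry.
Qed.

Variable H : sgraph.
Hypothesis HD : maxdeg H = D.
Hypothesis H0 : (0 < #|H|)%N.
Variable c : bool.
Hypothesis Hc : regular H D <-> c.

(** The limit densities: hubs used by a saturated set [S] with the other vertices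
    sent outside of both structures, and the clique used by the whole graph. *)
Definition planted_count : R :=
  \sum_(S : {set H} | saturated D S)
    (a%:R / (n%:R * p ^+ D)) ^+ #|S| * (1 - a%:R / n%:R - b%:R / n%:R) ^+ #|~: S| +
  c%:R * (b%:R / (n%:R * Num.sqrt (p ^+ D))) ^+ #|H|.

(** The events on the left exclude each other: [S] is the set of vertices sent to
    hubs, and in the last one all vertices are sent to the clique. *)
Lemma prod_full_weight_ge (phi : {ffun H -> 'I_n}) :
  \sum_(S : {set H} | saturated D S) p ^- (D * #|S|) *
     \prod_v (if v \in S then hub (phi v) else rest (phi v))%:R +
  c%:R * (p ^- #|edges H| * \prod_v (clique (phi v))%:R) <=
  \prod_(u in edges H) (full_weight (phi u.1) (phi u.2) / p).
Proof.
have w1 u : 1 <= full_weight (phi u.1) (phi u.2) / p.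
  by rewrite ler_pdivlMr // mul1r full_weight_ge.
have wp u : full_entry (phi u.1) (phi u.2) ->
    full_weight (phi u.1) (phi u.2) / p = p^-1.
  by rewrite /full_weight => ->; rewrite mul1r.
have hr i : ~~ (hub i && rest i).
  by rewrite /hub /rest; apply/negP => /andP[h1 h2];
     have := leq_trans h1 (leq_trans (leq_addr b a) h2); rewrite ltnn.
have hc i : ~~ (hub i && clique i).
  by rewrite /hub /clique; apply/negP => /and3P[h1 h2 _];
     have := leq_trans h1 h2; rewrite ltnn.
have cr i : ~~ (clique i && rest i).
  by rewrite /clique /rest; apply/negP => /andP[/andP[_ h1] h2];
     have := leq_trans h1 h2; rewrite ltnn.
have [/forallP allc|] := boolP [forall v, clique (phi v)].
  have [v0 _] := card_gt0P H0.
  rewrite big1 ?add0r => [|S _]; last first.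
    rewrite (bigD1 v0) //=; have := allc v0; have := hc (phi v0); have := cr (phi v0).
    by case: (v0 \in S); case: (hub _); case: (clique _); case: (rest _) => //=; rewrite !mul0r mulr0.
  rewrite [X in _ * (_ * X)]big1 => [|v _]; last by rewrite allc.
  rewrite mulr1 (eq_bigr (fun=> p^-1)) => [|u _]; last first.
    by rewrite wp // /full_entry !allc !orbT.
  by rewrite prodr_const exprVn ler_piMl ?invr_ge0 ?exprn_ge0 ?(ltW p0) //; case: (c).
rewrite negb_forall => /existsP[v0 /negbTE v0c].
rewrite [X in _ + c%:R * (_ * X)](bigD1 v0) //= v0c mul0r !mulr0 addr0.
pose S0 : {set H} := [set v | hub (phi v)].
have other S : S != S0 ->
    \prod_v (if v \in S then hub (phi v) else rest (phi v))%:R = 0 :> R.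
  move=> SS0; have [v vS] : exists v, (v \in S) != (v \in S0).
    apply/existsP; apply: contraR SS0; rewrite negb_exists => /forallP e.
    by apply/eqP/setP => v; have := e v; rewrite negbK => /eqP.
  rewrite (bigD1 v) //=; move: vS (hr (phi v)); rewrite inE.
  by case: (v \in S); case: (hub _); case: (rest _); rewrite //= mul0r.
have prod1 : 1 <= \prod_(u in edges H) (full_weight (phi u.1) (phi u.2) / p).
  apply: (@le_trans _ _ (\prod_(u in edges H) 1)); first by rewrite big1.
  by apply: ler_prod => u _; rewrite ler01 w1.
case: (boolP (saturated D S0)) => [sat|nsat]; last first.
  rewrite big1 ?(le_trans ler01) // => S Ssat; rewrite other ?mulr0 //.
  by apply: contraNneq nsat => <-.
rewrite (bigD1 S0) //= [X in _ + X]big1 ?addr0 => [|S /andP[_ SS0]]; last first.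
  by rewrite other ?mulr0.
apply: (@le_trans _ _ (p ^- (D * #|S0|))).
  rewrite ler_piMr ?invr_ge0 ?exprn_ge0 ?(ltW p0) //.
  by apply: prodr_ile1 => v _; rewrite ler0n lern1 leq_b1.
rewrite -(saturated_touching sat) (big_setID (touching S0)) /=.
have -> : edges H :&: touching S0 = touching S0.
  by apply/setP => u; rewrite !inE; case: (adj _ _ && _).
rewrite (eq_bigr (fun=> p^-1)) => [|u]; last first.
  by rewrite inE !inE => /andP[_ h]; rewrite wp // /full_entry orbA h.
rewrite prodr_const exprVn ler_peMr ?invr_ge0 ?exprn_ge0 ?(ltW p0) //.
apply: (@le_trans _ _ (\prod_(u in edges H :\: touching S0) 1)); first by rewrite big1.
by apply: ler_prod => u _; rewrite ler01 w1.
Qed.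

Lemma dens_full_ge : planted_count <= dens H (fun i j => full_weight i j / p).
Proof.
apply: le_trans (le_mean prod_full_weight_ge).
rewrite meanD mean_sum /planted_count le_eqVlt; apply/orP; left; apply/eqP.
congr (_ + _).
  apply: eq_bigr => S _; rewrite meanZ.
  rewrite (@mean_prod R H _ (fun v i => (if v \in S then hub i else rest i)%:R)).
  rewrite (bigID (mem S)) /= (eq_bigr (fun=> a%:R / n%:R)) => [|v vS]; last first.
    by rewrite vS mean_hub.
  rewrite [X in _ = _ * (_ * X)](eq_bigr (fun=> 1 - a%:R / n%:R - b%:R / n%:R)); last first.
    by move=> v /negbTE vS; rewrite vS mean_rest.
  rewrite !prodr_const mulrA invfM mulrA exprMn exprVn exprM [_ * (_ / _) ^+ _]mulrC.
  by congr (_ * _ ^+ _); apply: eq_card => v; rewrite inE.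
rewrite !meanZ (@mean_prod R H _ (fun v i => (clique i)%:R)).
rewrite (eq_bigr (fun=> b%:R / n%:R)) => [|v _]; last by rewrite mean_clique.
rewrite prodr_const; case: (boolP c) => [cc|_]; last by rewrite !mul0r.
rewrite !mul1r invfM mulrA [LHS]exprMn mulrC; congr (_ * _).
rewrite exprVn; congr (_^-1).
have pe0 : 0 <= p ^+ #|edges H| by rewrite exprn_ge0 // ltW.
have := regular_handshake (proj2 Hc cc) => hs.
apply: (@pexpIrn _ 2) => //; rewrite ?nnegrE ?exprn_ge0 ?sqrtr_ge0 //.
have -> : Num.sqrt (p ^+ D) ^+ #|H| ^+ 2 = p ^+ (D * #|H|).
  by rewrite -exprM mulnC exprM sqr_sqrtr ?exprn_ge0 ?(ltW p0) // -exprM.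
by rewrite -exprM [(#|edges H| * 2)%N]mulnC hs.
Qed.

(** The diagonal of [full_weight / p] has mean [D]-th power at most
    [(n * p ^+ D)^-1], so [dens_perturb] removes it. *)
Lemma hom_planted_ge (K eta : R) :
  1 + p ^- D * full_fraction <= K -> (n%:R * p ^+ D)^-1 <= eta ->
  planted_count - #|edges H|%:R * (eta `^ D%:R^-1 * K ^+ #|edges H|) <=
  hom_density p H planted.
Proof.
move=> hK heta; rewrite lerBlDr hom_densityE; apply: le_trans dens_full_ge _.
have pD0 : 0 < p ^- D by rewrite invr_gt0 exprn_gt0.
have ff0 : 0 <= full_fraction.
  by rewrite addr_ge0 ?mulr_ge0 ?exprn_ge0 ?divr_ge0 ?ler0n.
have K1 : 1 <= K by apply: le_trans hK; rewrite lerDl mulr_ge0 ?(ltW pD0).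
have w0 i j : 0 <= full_weight i j by apply: le_trans (full_weight_ge i j); apply: ltW.
pose dg i j : R := if i == j then full_weight i j / p else 0.
have split i j : full_weight i j / p = planted i j / p + dg i j.
  by rewrite mxE /dg; case: eqP => _; rewrite ?mul0r ?add0r ?addr0.
have -> : dens H (fun i j => full_weight i j / p) =
    dens H (fun i j => planted i j / p + dg i j).
  by apply: eq_mean => phi; apply: eq_bigr => u _; apply: split.
apply: dens_perturb => //.
- by move=> i j; rewrite mxE; case: ifP => _; rewrite ?mul0r // divr_ge0 // ltW.
- by move=> i j; rewrite /dg; case: ifP => // _; rewrite divr_ge0 // ltW.
- apply: le_trans hK.
  apply: (@le_trans _ _ (mean2 (fun i j => 1 + p ^- D * (full_entry i j)%:R))).
    apply: le_mean2 => i j; rewrite -split /full_weight; case: ifP => _.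
      by rewrite mul1r mulr1 exprVn lerDr.
    by rewrite divff ?gt_eqF // expr1n mulr0 addr0.
  by rewrite mean2D mean2_cst // lerD2l mean2Z ler_wpM2l ?(ltW pD0) // mean2_full_entry.
- apply: le_trans heta.
  apply: (@le_trans _ _ (mean2 (fun i j : 'I_n => (i == j)%:R * p ^- D))).
    apply: le_mean2 => i j; rewrite /dg; case: eqP => _; last by rewrite mul0r expr0n gtn_eqF.
    rewrite mul1r exprMn exprVn ler_piMl ?(ltW pD0) //.
    by apply: exprn_ile1; rewrite ?full_weight_le1.
  rewrite invfM [leRHS]mulrC le_eqVlt; apply/orP; left; apply/eqP.
  rewrite (_ : mean2 _ = mean2 (fun i j : 'I_n => p ^- D * (i == j)%:R)); last first.
    by apply: eq_mean => i; apply: eq_mean => j; rewrite mulrC.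
  rewrite mean2Z; congr (_ * _); rewrite /mean2 /mean card_ord -mulr_sumr.
  rewrite (eq_bigr (fun=> 1)) => [|i _]; last first.
    by rewrite (bigD1 i) //= eqxx big1 ?addr0 // => j; rewrite eq_sym => /negbTE ->.
  by rewrite sumr_const card_ord mulVf ?mulr1 // pnatr_eq0 -lt0n.
Qed.

End Planted.

Local Open Scope classical_set_scope.
Local Open Scope ring_scope.

Section Limits.
Variable R : realType.

Lemma cvg_bigsum (T : Type) (F : set_system T) (FF : Filter F) (I : Type) (r : seq I)
    (P : pred I) (f : I -> T -> R) (l : I -> R) :
  (forall i, P i -> f i x @[x --> F] --> l i) ->
  \sum_(i <- r | P i) f i x @[x --> F] --> \sum_(i <- r | P i) l i.
Proof.
move=> h; elim: r => [|i r IH].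
  under eq_cvg do rewrite big_nil.
  by rewrite big_nil; apply: cvg_cst.
under eq_cvg do rewrite big_cons.
rewrite big_cons; case: ifP => // Pi.
exact: (cvgD (h i Pi) IH).
Qed.

Lemma cvg_expn (T : Type) (F : set_system T) (FF : Filter F) (f : T -> R) (l : R) m :
  f x @[x --> F] --> l -> f x ^+ m @[x --> F] --> l ^+ m.
Proof.
move=> fl; apply: (@continuous_cvg _ _ _ _ _ f (fun x : R => x ^+ m)) => //.
exact: exprn_continuous.
Qed.

Lemma cvg_squeeze_below (f e : nat -> R) (l : R) :
  (\forall n \near \oo, l - e n <= f n <= l) -> e n @[n --> \oo] --> (0 : R) ->
  f n @[n --> \oo] --> l.
Proof.
move=> fl e0; apply: (squeeze_cvgr fl); last exact: cvg_cst.
rewrite -[X in _ --> X]subr0; exact: (cvgB (cvg_cst l) e0).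
Qed.

(** Plant [x + tau] instead of [x]: the surplus makes the constraints strict in
    the limit, hence true for large [n]. Rounding the sizes of the hub set and
    of the clique costs [(n p^D)^-1], which tends to 0 by the lower bound on
    [p]. *)
Lemma upper_bound (k s D : nat) (H : 'I_k -> sgraph) (delta : 'I_k -> R) (x y tau : R)
    (p : nat -> R) :
  (forall i, connected_graph (H i)) -> (2 <= D)%N -> (forall i, maxdeg (H i) = D) ->
  (forall i : 'I_k, regular (H i) D <-> (i < s)%N) ->
  feasible s H delta x y -> 0 < tau ->
  (\forall n \near \oo, 0 < p n < 1) ->
  (n%:R `^ (- (D%:R)^-1) / p n) @[n --> \oo] --> (0 : R) ->
  p n @[n --> \oo] --> (0 : R) ->
  \forall n \near \oo, exists2 X : 'M[R]_n,
    admissible (p n) H (fun i => 1 + delta i) X &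
    relent_mx (p n) X / (2 * anp D n (p n)) <= x + tau + 2^-1 * y ^+ 2.
Proof.
move=> Hconn D2 HD Hreg [x0 y0 feas] tau0 p01 u_cvg p_cvg.
have D0 : (0 < D)%N by apply: ltn_trans D2.
have n_pos : \forall n \near \oo, (0 < n)%N by exact: nbhs_infty_gt.
pose x' := x + tau; have x'0 : 0 < x' by rewrite /x'; lra.
pose u n : R := n%:R `^ (- (D%:R)^-1) / p n.
pose eta n := u n ^+ D.
have eta_cvg : eta n @[n --> \oo] --> (0 : R).
  have -> : 0 = 0 ^+ D :> R by rewrite expr0n gtn_eqF.
  exact: cvg_expn.
have etaE n : (0 < n)%N -> 0 < p n < 1 -> eta n = (n%:R * p n ^+ D)^-1.
  move=> n0 /andP[p0 _]; rewrite /eta /u exprMn exprVn invfM; congr (_ * _).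
  rewrite -powR_mulrn ?powR_ge0 // -powRrM mulNr mulVf ?powR_inv1 ?ler0n //.
  by rewrite pnatr_eq0 -lt0n.
have u_root n : 0 < p n < 1 -> eta n `^ D%:R^-1 = u n.
  by move=> /andP[p0 _]; rewrite powR_root // divr_ge0 ?powR_ge0 // ltW.
pose r n := Num.sqrt (p n ^+ D).
have pD_le n : 0 < p n < 1 -> p n ^+ D <= p n.
  by move=> /andP[p0 p1]; rewrite -[leRHS]expr1 ler_wiXn2l // ltW.
have r_le n : 0 < p n < 1 -> r n <= p n.
  move=> /andP[p0 p1]; have e : Num.sqrt (p n ^+ 2) = p n by rewrite sqrtr_sqr gtr0_norm.
  by rewrite /r -[leRHS]e ler_wsqrtr // ler_wiXn2l // ltW.
have r_gt0 n : 0 < p n < 1 -> 0 < r n.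
  by move=> /andP[p0 _]; rewrite sqrtr_gt0 exprn_gt0.
have r_ge n : 0 < p n < 1 -> p n ^+ D <= r n.
  move=> p01n; have /andP[p0 p1] := p01n; have r2 : p n ^+ D = r n ^+ 2.
    by rewrite sqr_sqrtr // exprn_ge0 // ltW.
  by rewrite r2 -[leRHS]expr1 ler_wiXn2l ?sqrtr_ge0 // (le_trans (r_le _ p01n)) // ltW.
pose a n := Num.truncn (x' * (n%:R * p n ^+ D)).
pose b n := Num.truncn (y * (n%:R * r n)).
pose al n : R := (a n)%:R / (n%:R * p n ^+ D).
pose be n : R := (b n)%:R / (n%:R * r n).
pose om n : R := 1 - (a n)%:R / n%:R - (b n)%:R / n%:R.
have trunc_bound (z w e : R) : 0 <= z -> 0 < w -> w^-1 <= e ->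
    z - e <= (Num.truncn (z * w))%:R / w <= z.
  move=> z0 w0 we; have /andP[h1 h2] := truncn_itv (mulr_ge0 z0 (ltW w0)).
  rewrite ler_pdivrMr // h1 andbT lerBlDr; apply: (@le_trans _ _
    ((Num.truncn (z * w))%:R / w + w^-1)); last by rewrite lerD2l.
  have -> : (Num.truncn (z * w))%:R / w + w^-1 = ((Num.truncn (z * w))%:R + 1) / w.
    by rewrite mulrDl mul1r.
  by rewrite ler_pdivlMr // ltW // natr1.
have al_bound n : (0 < n)%N -> 0 < p n < 1 -> x' - eta n <= al n <= x'.
  move=> n0 p01n; have /andP[p0 _] := p01n; apply: trunc_bound.
  - exact: ltW.
  - by rewrite mulr_gt0 ?ltr0n ?exprn_gt0.
  - by rewrite etaE.
have be_bound n : (0 < n)%N -> 0 < p n < 1 -> y - eta n <= be n <= y.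
  move=> n0 p01n; have /andP[p0 _] := p01n; apply: trunc_bound => //.
  - by rewrite mulr_gt0 ?ltr0n ?r_gt0.
  - rewrite etaE // lef_pV2 ?posrE ?mulr_gt0 ?ltr0n ?exprn_gt0 ?r_gt0 //.
    by rewrite ler_pM2l ?ltr0n // r_ge.
have a_le n : (0 < n)%N -> 0 < p n < 1 -> (a n)%:R / n%:R <= x' * p n.
  move=> n0 p01n; have /andP[p0 _] := p01n.
  rewrite ler_pdivrMr ?ltr0n //; apply: (@le_trans _ _ (x' * (n%:R * p n ^+ D))).
    by rewrite truncn_le mulr_ge0 ?(ltW x'0) // mulr_ge0 ?ler0n ?exprn_ge0 ?(ltW p0).
  by rewrite -mulrA ler_pM2l // mulrC ler_pM2r ?ltr0n // pD_le.
have b_le n : (0 < n)%N -> 0 < p n < 1 -> (b n)%:R / n%:R <= y * p n.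
  move=> n0 p01n; have /andP[p0 _] := p01n.
  rewrite ler_pdivrMr ?ltr0n //; apply: (@le_trans _ _ (y * (n%:R * r n))).
    by rewrite truncn_le mulr_ge0 // mulr_ge0 ?ler0n ?(ltW (r_gt0 _ _)).
  by rewrite -mulrA ler_wpM2l // mulrC ler_pM2r ?ltr0n // r_le.
have al_cvg : al n @[n --> \oo] --> x'.
  by apply: cvg_squeeze_below eta_cvg; apply: filterS2 n_pos p01 => n; exact: al_bound.
have be_cvg : be n @[n --> \oo] --> y.
  by apply: cvg_squeeze_below eta_cvg; apply: filterS2 n_pos p01 => n; exact: be_bound.
have xyp_cvg : (x' + y) * p n @[n --> \oo] --> (0 : R).
  by rewrite -[X in _ --> X](mulr0 (x' + y)); apply: cvgMr.
have om_cvg : om n @[n --> \oo] --> (1 : R).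
  apply: cvg_squeeze_below xyp_cvg; apply: filterS2 n_pos p01 => n n0 p01n.
  have := a_le n n0 p01n; have := b_le n n0 p01n; rewrite /om.
  have : 0 <= (a n)%:R / n%:R :> R by rewrite divr_ge0.
  have : 0 <= (b n)%:R / n%:R :> R by rewrite divr_ge0.
  by move=> *; apply/andP; split; lra.
pose K := 1 + 2 * x' + y ^+ 2.
pose G (i : 'I_k) n : R :=
  \sum_(S : {set H i} | saturated D S) al n ^+ #|S| * om n ^+ #|finset.setC S| +
  (i < s)%N%:R * be n ^+ #|H i| -
  #|edges (H i)|%:R * K ^+ #|edges (H i)| * u n.
have G_cvg i : G i n @[n --> \oo] -->
    (indep_poly (star (H i)) R).[x'] + (i < s)%N%:R * y ^+ #|H i|.
  rewrite horner_star_poly HD -[X in _ --> X]subr0; apply: cvgB.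
    apply: cvgD; last by apply: cvgMr; apply: cvg_expn.
    apply: cvg_bigsum => S _; rewrite -[X in _ --> X]mulr1; apply: cvgM.
      exact: cvg_expn.
    by rewrite -(expr1n _ #|finset.setC S|); apply: cvg_expn.
  by rewrite -[X in _ --> X](mulr0 (#|edges (H i)|%:R * K ^+ #|edges (H i)|)); apply: cvgMr.
have G_gt : \forall n \near \oo, forall i, 1 + delta i < G i n.
  apply: (@filter_forall _ _ (fun i n => 1 + delta i < G i n)) => i.
  apply: (cvgr_gt _ (G_cvg i)); apply: le_lt_trans (feas i) _.
  have Hi0 : (0 < #|H i|)%N by case: (Hconn i).
  have h := star_poly_growth Hi0 x0 (ltW tau0).
  have -> : (i < s)%N%:R * y ^+ #|star (H i)| = (i < s)%N%:R * y ^+ #|H i|.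
    case: (boolP (i < s)%N) => [si|_]; last by rewrite !mul0r.
    congr (_ * _ ^+ _); rewrite card_sig; apply: eq_card => z; rewrite !inE.
    by have /Hreg -> := si; rewrite HD eqxx.
  by rewrite ltrD2r; apply: lt_le_trans h; rewrite ltrDl.
have xyp_lt : \forall n \near \oo, (x' + y) * p n < 1.
  by apply: (cvgr_lt _ xyp_cvg); exact: ltr01.
have good : \forall n \near \oo, [/\ (0 < n)%N, 0 < p n < 1,
    forall i, 1 + delta i < G i n & (x' + y) * p n < 1].
  apply: filterS (filterI (filterI n_pos p01) (filterI G_gt xyp_lt)) => n.
  by move=> [[? ?] [? ?]].
apply: filterS good => n [n0 p01n Gn xypn].
have /andP[p0 p1] := p01n.
have nR0 : 0 < n%:R :> R by rewrite ltr0n.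
have pD0 : 0 < p n ^+ D by rewrite exprn_gt0.
have r0 := r_gt0 n p01n.
have ab_le : (a n + b n <= n)%N.
  rewrite -(ler_nat R) natrD.
  have := a_le n n0 p01n; have := b_le n n0 p01n.
  rewrite !ler_pdivrMr // => hb ha.
  have : (x' + y) * p n * n%:R <= 1 * n%:R by rewrite ler_pM2r // ltW.
  lra.
have /andP[_ al_le] := al_bound n n0 p01n.
have /andP[_ be_le] := be_bound n n0 p01n.
have ffE : p n ^- D * full_fraction R n (a n) (b n) = 2 * al n + be n ^+ 2.
  have rE : p n ^+ D = r n ^+ 2 by rewrite sqr_sqrtr // ltW.
  rewrite /full_fraction /al /be rE; field.
  by rewrite !gt_eqF.
have be0 : 0 <= be n by rewrite divr_ge0 // mulr_ge0 ?ltW.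
have be2 : be n ^+ 2 <= y ^+ 2 by apply: lerXn2r; rewrite ?nnegrE.
have ff_le : p n ^- D * full_fraction R n (a n) (b n) <= 2 * x' + y ^+ 2.
  by rewrite ffE lerD // ler_pM2l.
exists (planted n (a n) (b n) (p n)).
  split; first exact: wgraph_planted.
  move=> i; apply: le_trans (ltW (Gn i)) _.
  have Hi0 : (0 < #|H i|)%N by case: (Hconn i).
  apply: le_trans (hom_planted_ge n0 ab_le D0 p01n (HD i) Hi0 (Hreg i)
     (K := K) (eta := eta n) _ _); last by rewrite etaE.
    by rewrite /G u_root // /planted_count -mulrA [u n * _]mulrC.
  by rewrite /K -addrA lerD2l.
have l0 : 0 < ln (p n)^-1 by rewrite ln_gt0 // invf_gt1.
rewrite ler_pdivrMr; last by rewrite /anp !mulr_gt0 // exprn_gt0.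
apply: le_trans (relent_planted n0 ab_le p01n) _.
have -> : n%:R ^+ 2 * ln (p n)^-1 * full_fraction R n (a n) (b n) =
  n%:R ^+ 2 * ln (p n)^-1 * p n ^+ D * (p n ^- D * full_fraction R n (a n) (b n)).
  by field; rewrite gt_eqF.
have -> : (x + tau + 2^-1 * y ^+ 2) * (2 * anp D n (p n)) =
  n%:R ^+ 2 * ln (p n)^-1 * p n ^+ D * (2 * x' + y ^+ 2).
  by rewrite /anp /x'; field.
by rewrite ler_wpM2l // !mulr_ge0 ?sqr_ge0 // ltW.
Qed.

End Limits.

(** * Existence of the minimum and convergence *)

Section Minimum.
Variables (R : realType) (k s : nat) (H : 'I_k -> sgraph) (delta : 'I_k -> R).
Hypothesis H0 : forall i, (0 < #|H i|)%N.
Hypothesis delta0 : forall i, 0 <= delta i.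

(** Feasible points below a given objective value form a compact set; there is
    a feasible point with [y = 0] since the polynomials are unbounded. *)
Lemma objective_minimum : exists c, is_minimum (objective_values s H delta) c.
Proof.
pose x1 : R := \sum_i (1 + delta i).
have x1_ge i : 1 + delta i <= x1.
  by rewrite /x1 (bigD1 i) //= lerDl sumr_ge0 // => j _; rewrite addr_ge0.
have x10 : 0 <= x1 by rewrite sumr_ge0 // => i _; rewrite addr_ge0.
have feas1 : feasible s H delta x1 0.
  split=> // i; apply: le_trans (x1_ge i) _.
  have := @star_poly_growth R (H i) 0 x1 (H0 i) (lexx 0) x10; rewrite add0r.
  have : 0 <= (indep_poly (star (H i)) R).[0].
    by rewrite horner_star_poly sumr_ge0 // => S _; rewrite exprn_ge0.
  have : 0 <= (i < s)%N%:R * 0 ^+ #|star (H i)| :> R by rewrite mulr_ge0 ?exprn_ge0.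
  lra.
pose obj (z : R * R) := z.1 + 2^-1 * z.2 ^+ 2.
pose G i (z : R * R) := (indep_poly (star (H i)) R).[z.1] +
  (i < s)%N%:R * z.2 ^+ #|star (H i)|.
have obj_cont : continuous obj.
  move=> z; apply: cvgD; first exact: cvg_fst.
  by apply: cvgMr; apply: cvg_expn; exact: cvg_snd.
have G_cont i : continuous (G i).
  move=> z; rewrite /continuous_at /G; under eq_cvg do rewrite horner_star_poly.
  rewrite horner_star_poly; apply: cvgD.
    by apply: cvg_bigsum => S _; apply: cvg_expn; exact: cvg_fst.
  by apply: cvgMr; apply: cvg_expn; exact: cvg_snd.
pose A : set (R * R) := [set z | feasible s H delta z.1 z.2 /\ obj z <= x1].
have AE : A = fst @^-1` [set x : R | 0 <= x] `&` snd @^-1` [set x : R | 0 <= x] `&`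
    (\bigcap_i G i @^-1` [set x : R | 1 + delta i <= x]) `&` obj @^-1` [set x : R | x <= x1].
  apply/seteqP; split=> z /=.
    by move=> [[? ? h] ?]; do !split => //; move=> i _; apply: h.
  by move=> [[[? ?] h] ?]; split=> //; split=> // i; apply: h.
have Aclosed : closed A.
  rewrite AE; apply: closedI; last first.
    by apply: closed_comp (@closed_le R x1) => z _; exact: obj_cont.
  apply: closedI; last first.
    by apply: closed_bigI => i _; apply: closed_comp (@closed_ge R _) => z _; exact: G_cont.
  apply: closedI; apply: closed_comp (@closed_ge R _) => z _; [exact: cvg_fst|exact: cvg_snd].
have Acompact : compact A.
  apply: (subclosed_compact Aclosed (compact_setX (@segment_compact R 0 x1)
     (@segment_compact R 0 (x1 + 1)))).
  move=> [x y] [[/= x0 y0 _] hobj]; rewrite /obj /= in hobj.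
  have y2 : 0 <= y ^+ 2 by apply: sqr_ge0.
  split; rewrite /= in_itv /=; first by rewrite x0 /=; lra.
  rewrite y0 /=; rewrite -(ler_pXn2r (_ : 0 < 2)%N) ?nnegrE //; last lra.
  have : 0 <= x1 ^+ 2 by apply: sqr_ge0.
  have -> : (x1 + 1) ^+ 2 = x1 ^+ 2 + 2 * x1 + 1 by ring.
  lra.
have A1 : A (x1, 0) by split=> //; rewrite /obj /= expr0n mulr0 addr0.
have Acont : {within A, continuous obj} by apply: continuous_subspaceT.
have [z zA zmin] := compact_EVT_min (ex_intro _ _ A1) Acompact Acont.
move: zA; rewrite inE => -[zf zle].
exists (obj z); split; first by exists z.1, z.2.
move=> _ [x [y [fxy ->]]]; have [le|lt] := leP (obj (x, y)) x1.
  by apply: (zmin (x, y)); rewrite inE.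
exact: le_trans zle (ltW lt).
Qed.

End Minimum.

(** A witness makes the infimum finite, so the normalisation can be carried out
    in real numbers. *)
Lemma phi_between (R : realType) (D n : nat) (p : R) (k : nat) (H : 'I_k -> sgraph)
    (t : 'I_k -> R) (lo hi : R) :
  0 < anp D n p ->
  (forall X : 'M[R]_n, admissible p H t X -> lo <= relent_mx p X / (2 * anp D n p)) ->
  (exists2 X : 'M[R]_n, admissible p H t X & relent_mx p X / (2 * anp D n p) <= hi) ->
  exists2 v, phi D n p H t = v%:E & lo <= v <= hi.
Proof.
move=> a0 hlo [X Xadm Xhi]; set S := [set (relent_mx p Y)%:E | Y in @admissible R n p k H t].
have a20 : 0 < 2 * anp D n p by rewrite mulr_gt0.
have inf_le : (ereal_inf S <= (hi * (2 * anp D n p))%:E)%E.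
  apply: (@le_trans _ _ (relent_mx p X)%:E); first by apply: ereal_inf_lbound; exists X.
  by rewrite lee_fin -ler_pdivrMr.
have inf_ge : ((lo * (2 * anp D n p))%:E <= ereal_inf S)%E.
  apply: le_ereal_inf_tmp => _ [Y Yadm <-].
  by rewrite lee_fin -ler_pdivlMr // hlo.
have [r rE] : exists r, ereal_inf S = r%:E.
  by move: inf_le inf_ge; case: (ereal_inf S) => [r| |] //; exists r.
move: inf_le inf_ge; rewrite rE !lee_fin => inf_le inf_ge.
exists (r / (2 * anp D n p)); last by rewrite ler_pdivlMr // ler_pdivrMr // inf_ge.
rewrite /phi /Phi -/S rE -!EFinM; congr (_%:E); field.
by rewrite gt_eqF.
Qed.

Unset Implicit Arguments.

Theorem proposition1p10 (R : realType) (k s Delta : nat) (H : 'I_k -> sgraph)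
    (delta : 'I_k -> R) (p : nat -> R)
    (k_gt0 : (1 <= k)%N)
    (H_connected : forall i, connected_graph (H i))
    (Delta_ge2 : (2 <= Delta)%N)
    (H_maxdeg : forall i, maxdeg (H i) = Delta)
    (H_regular : forall i : 'I_k, regular (H i) Delta <-> (i < s)%N)
    (delta_ge0 : forall i, 0 <= delta i)
    (p01 : \forall n \near \oo, 0 < p n < 1)
    (p_lower : (n%:R `^ (- (Delta%:R)^-1) / p n) @[n --> \oo] --> (0 : R))
    (p_upper : p n @[n --> \oo] --> (0 : R)) :
  exists c : R,
    is_minimum (objective_values s H delta) c /\
    phi Delta n (p n) H (fun i => 1 + delta i) @[n --> \oo] --> c%:E.
Proof.
have H0 i : (0 < #|H i|)%N by case: (H_connected i).
have [c cmin] := objective_minimum s H0 delta_ge0.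
exists c; split=> //; have [[x [y [feas cE]]] clb] := cmin.
have c0 : 0 <= c.
  by have [x0 y0 _] := feas; rewrite cE addr_ge0 // mulr_ge0 ?exprn_ge0 // invr_ge0.
have between tau : 0 < tau -> \forall n \near \oo,
    exists2 v, phi Delta n (p n) H (fun i => 1 + delta i) = v%:E &
      c - tau <= v <= c + tau.
  move=> tau0; have [q q0 lower] := lower_bound H_connected Delta_ge2 H_maxdeg H_regular clb c0 tau0.
  have upper := upper_bound H_connected Delta_ge2 H_maxdeg H_regular feas tau0 p01 p_lower p_upper.
  have p_lt : \forall n \near \oo, p n < q by apply: (cvgr_lt _ p_upper).
  have n_pos : \forall n \near \oo, (0 < n)%N by exact: nbhs_infty_gt.
  apply: filterS (filterI (filterI upper p_lt) (filterI n_pos p01)) => n.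
  move=> [[[X Xadm Xle] pq] [n0 /andP[p0 p1]]]; apply: phi_between.
  - by rewrite /anp !mulr_gt0 ?exprn_gt0 ?ltr0n // ln_gt0 // invf_gt1.
  - by move=> Y; apply: lower => //; rewrite p0.
  - by exists X => //; rewrite cE addrAC.
apply/fine_cvgP; split.
  by apply: filterS (between 1 ltr01) => n [v -> _].
apply/cvgrPdist_le => tau tau0; apply: filterS (between tau tau0) => n [v /= -> /=].
by rewrite ler_distlC.
Qed.
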